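(* Let $K$ be a field and let $M$ be a matroid. If $M$ has no minor isomorphic to any of $M(K_4)$, $\mathcal W^3$, $P_6$, or $Q_6$, then the toric ideal $J_M$ has a Gr\''obner basis (with respect to some monomial order) consisting of quadratic binomials.
   Context: For a matroid $M$ on $E$ with bases $B_1,\dots,B_n$, the toric ideal is $J_M=\ker\big(K[x_1,\dots,x_n]\to K[s_e:e\in E],\ x_j\mapsto\prod_{e\in B_j}s_e\big)$. A minor of $M$ is a matroid obtained from $M$ by a finite sequence of deletions and contractions of elements. The four excluded matroids are the rank-3 simple matroids on 6 elements (standard notation as in Oxley's Matroid Theory): $M(K_4)$ is the cycle matroid of the complete graph $K_4$ (four 3-point lines); $\mathcal W^3$ is the rank-3 whirl (exactly three 3-point lines, pairwise meeting, forming a triangle); $P_6$ has exactly one 3-point line and no other nontrivial lines; $Q_6$ has exactly two 3-point lines, which meet in a point, and no other nontrivial lines.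
   Formalization: The matroid M is assumed to have positive rank; for rank 0 the only basis is the empty set, so J_M = (x_1 − 1), which has no Gröbner basis of quadratic binomials although M has none of the excluded minors. *)

(* Defs.v *)
From HB Require Import structures.
From mathcomp Require Import all_boot all_order all_algebra.
From mathcomp Require Import mpoly.

Set Implicit Arguments.
Unset Strict Implicit.
Unset Printing Implicit Defensive.

Import GRing.Theory.

(* The ground set is a subset of an ambient finite type, so that the minors of
   a matroid are matroids over the same type. *)
Record matroid (T : finType) := Matroid {
  mground : {set T};
  mbases : {set {set T}};
  mbases_neq0 : mbases != set0;
  mbases_sub : forall B, B \in mbases -> B \subset mground;
  mbases_exchange : forall A B x, A \in mbases -> B \in mbases ->
    x \in A :\: B -> exists2 y, y \in B :\: A & y |: (A :\ x) \in mbases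
}.

Definition mrank (T : finType) (M : matroid T) : nat :=
  \max_(B in mbases M) #|B|.

Section Minors.
Variables (T : finType) (M : matroid T) (e : T).

(* e is a coloop when it lies in every basis, and a loop when in none. *)
Definition mcoloop := [forall B in mbases M, e \in B].
Definition mloop := [forall B in mbases M, e \notin B].

Definition link_bases := [set B :\ e | B in mbases M & e \in B].
Definition avoid_bases := [set B in mbases M | e \notin B].
Definition del_bases := if mcoloop then link_bases else avoid_bases.
Definition contr_bases := if mloop then avoid_bases else link_bases.

Lemma avoid_neq0 : ~~ mcoloop -> avoid_bases != set0.
Proof.
rewrite negb_forall => /existsP[B]; rewrite negb_imply => /andP[BM eB].
by apply/set0Pn; exists B; rewrite inE BM eB.
Qed.

Lemma link_neq0 : ~~ mloop -> link_bases != set0.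
Proof.
rewrite negb_forall => /existsP[B]; rewrite negb_imply negbK => /andP[BM eB].
by apply/set0Pn; exists (B :\ e); apply/imsetP; exists B; rewrite ?inE ?BM.
Qed.

Lemma mcoloopNloop : mcoloop -> ~~ mloop.
Proof.
move=> /forall_inP co; apply/negP => /forall_inP lo.
by have /set0Pn[B BM] := mbases_neq0 M; have := lo B BM; rewrite co.
Qed.

Lemma avoid_sub B : B \in avoid_bases -> B \subset mground M :\ e.
Proof. by rewrite inE => /andP[/mbases_sub BM eB]; rewrite subsetD1 BM. Qed.

Lemma link_sub B : B \in link_bases -> B \subset mground M :\ e.
Proof.
by case/imsetP => A; rewrite inE => /andP[/mbases_sub AM _] ->; apply: setSD.
Qed.

Lemma avoid_exchange A B x : A \in avoid_bases -> B \in avoid_bases ->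
  x \in A :\: B -> exists2 y, y \in B :\: A & y |: (A :\ x) \in avoid_bases.
Proof.
rewrite !inE => /andP[AM eA] /andP[BM eB] xAB.
have [|y yBA yA] := @mbases_exchange _ M A B x AM BM; first by rewrite inE.
exists y => //; rewrite !inE yA /= (negPf eA) andbF orbF.
by apply: contraNneq eB => ->; move: yBA; rewrite inE => /andP[].
Qed.

Lemma link_exchange A B x : A \in link_bases -> B \in link_bases ->
  x \in A :\: B -> exists2 y, y \in B :\: A & y |: (A :\ x) \in link_bases.
Proof.
case/imsetP => A' A'e ->; case/imsetP => B' B'e ->; move: A'e B'e.
rewrite !inE => /andP[AM eA] /andP[BM eB] /and3P[xB xe xA].
have {xB}xNB : x \notin B' by move: xB; rewrite xe.
have [|y] := @mbases_exchange _ M A' B' x AM BM.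
  by rewrite !inE xNB xA.
rewrite inE => /andP[yA yB] yM.
have ye : y != e by apply: contraNneq yA => ->.
exists y; first by rewrite !inE ye yB (negPf yA).
apply/imsetP; exists (y |: (A' :\ x)).
  by rewrite !inE yM eA (eq_sym e x) xe orbT.
apply/setP => z; rewrite !inE.
have [->|] := eqVneq z y; first by rewrite ye.
by move=> _ /=; case: (z != e); rewrite ?andbF.
Qed.

Lemma del_neq0 : del_bases != set0.
Proof.
rewrite /del_bases; case: ifPn => [/mcoloopNloop/link_neq0 //|].
exact: avoid_neq0.
Qed.

Lemma del_sub B : B \in del_bases -> B \subset mground M :\ e.
Proof.
by rewrite /del_bases; case: ifP => _; [apply: link_sub | apply: avoid_sub].
Qed.

Lemma del_exchange A B x : A \in del_bases -> B \in del_bases ->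
  x \in A :\: B -> exists2 y, y \in B :\: A & y |: (A :\ x) \in del_bases.
Proof.
rewrite /del_bases.
by case: ifP => _; [apply: link_exchange | apply: avoid_exchange].
Qed.

Definition mdel : matroid T := Matroid del_neq0 del_sub del_exchange.

Lemma contr_neq0 : contr_bases != set0.
Proof.
rewrite /contr_bases; case: ifPn => [lo|]; last exact: link_neq0.
by apply: avoid_neq0; apply: contraTN lo; apply: mcoloopNloop.
Qed.

Lemma contr_sub B : B \in contr_bases -> B \subset mground M :\ e.
Proof.
by rewrite /contr_bases; case: ifP => _; [apply: avoid_sub | apply: link_sub].
Qed.

Lemma contr_exchange A B x : A \in contr_bases -> B \in contr_bases ->
  x \in A :\: B -> exists2 y, y \in B :\: A & y |: (A :\ x) \in contr_bases.
Proof.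
rewrite /contr_bases.
by case: ifP => _; [apply: avoid_exchange | apply: link_exchange].
Qed.

Definition mcontr : matroid T := Matroid contr_neq0 contr_sub contr_exchange.

End Minors.

Inductive is_minor (T : finType) (M : matroid T) : matroid T -> Prop :=
| minor_refl : is_minor M M
| minor_del N e : is_minor M N -> e \in mground N -> is_minor M (mdel N e)
| minor_contr N e : is_minor M N -> e \in mground N -> is_minor M (mcontr N e).

Definition matroid_iso (T U : finType) (M : matroid T) (N : matroid U) : Prop :=
  exists2 f : {x in mground M} -> {y in mground N}, bijective f &
    forall A : {set {x in mground M}},
      ([set val x | x in A] \in mbases M) =
      ([set val (f x) | x in A] \in mbases N).

Definition has_minor (T U : finType) (M : matroid T) (N : matroid U) : Prop :=
  exists2 N' : matroid T, is_minor M N' & matroid_iso N' N.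

Section CycleMatroid.
Variable V : finType.
Implicit Types (F G A : {set {set V}}) (x y u v : V).

(* A simple graph is given by its set of edges, each an unordered pair. *)
Definition adj F : rel V := fun x y => (x != y) && ([set x; y] \in F).

(* Closed walks of length at most 2 without repeated vertices satisfy [ucycle]
   but are not cycles of the graph. A vertex-simple sequence has size at most
   #|V|, whence the bound on k. *)
Definition forest F :=
  [forall k : 'I_#|V|.+1, forall c : k.-tuple V,
     ucycleb (adj F) c ==> (k <= 2)].

Lemma forestP F :
  reflect (forall c : seq V, ucycle (adj F) c -> size c <= 2) (forest F).
Proof.
apply: (iffP forallP) => [h c uc | h k].
  have sc : size c < #|V|.+1.
    by case/andP: uc => _ /card_uniqP <-; rewrite ltnS max_card.
  by have /forallP/(_ (in_tuple c))/implyP := h (Ordinal sc); apply.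
by apply/forallP => c; apply/implyP => /h; rewrite size_tuple.
Qed.

Lemma set2C x y : [set x; y] = [set y; x].
Proof. by rewrite setUC. Qed.

Lemma set2_eq x y u v : [set x; y] = [set u; v] ->
  (x = u /\ y = v) \/ (x = v /\ y = u).
Proof.
move=> e.
have := set21 x y; have := set22 x y; have := set21 u v; have := set22 u v.
rewrite {1 2}(esym e) {3 4}e !inE.
case/orP => /eqP h1; case/orP => /eqP h2; case/orP => /eqP h3;
  case/orP => /eqP h4; subst; tauto.
Qed.

Lemma adj_sym F : ssrbool.symmetric (adj F).
Proof. by move=> x y; rewrite /adj eq_sym set2C. Qed.

Lemma connect_adjC F : connect_sym (adj F).
Proof. exact: sym_connect_sym (@adj_sym F). Qed.

Lemma sub_connect_adj F A x y :
  F \subset A -> connect (adj F) x y -> connect (adj A) x y.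
Proof.
move=> /subsetP FA; apply: connect_sub => a b /= /andP[ab abF].
by apply: connect1; rewrite /adj ab FA.
Qed.

Lemma forest_bridgeP F :
  forest F <-> (forall x y, x != y -> [set x; y] \in F ->
                ~ connect (adj (F :\ [set x; y])) x y).
Proof.
split=> [/forestP acF x y xy xyF | br].
  case/connectP => p0 /shortenP[p pth up _] ly.
  have pF : path (adj F) x p.
    apply: sub_path pth => a b; rewrite /adj !inE.
    by case/and3P => -> _ ->.
  have /acF : ucycle (adj F) (x :: p).
    rewrite /ucycle up andbT /= rcons_path pF -ly /=.
    by rewrite /adj eq_sym xy set2C xyF.
  case: p pth ly {up pF} => [|z [|//]] /=.
    by move=> _ e; rewrite e eqxx in xy.
  by rewrite /adj andbT !inE => /and3P[_ h _] e; rewrite e eqxx in h.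
apply/forestP => -[//|x [//|z q]] /andP[] /=.
rewrite rcons_path /= => /and3P[/andP[xz xzF] pq /andP[yx yxF]].
rewrite inE negb_or => /andP[/andP[xNz xNq] /andP[zNq uq]].
case: q => [//|w q] in pq yx yxF xNq zNq uq *.
set y := last z (w :: q) in yx yxF.
have yq : y \in w :: q by rewrite /y /= mem_last.
case: (br x y); [by rewrite eq_sym | by rewrite set2C |].
have zy : z != y by apply: contraNneq zNq => ->.
apply: (@connect_trans _ _ z).
  apply: connect1; rewrite /adj xz !inE xzF andbT.
  apply/eqP => /set2_eq[[_ e]|[e _]]; first by case/eqP: zy.
  by case/eqP: yx.
apply/connectP; exists (w :: q) => //.
apply: (@sub_in_path _ (predC1 x) (adj F)) pq.
  move=> a b; rewrite !inE => ax bx /andP[ab abF].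
  rewrite /adj ab !inE abF andbT.
  by apply/eqP => /set2_eq[[e _]|[_ e]];
    [rewrite e eqxx in ax | rewrite e eqxx in bx].
apply/allP => a; rewrite inE => /predU1P[->|aq] /=; first by rewrite eq_sym.
by apply: contraNneq xNq => <-.
Qed.

Lemma connect_add1 F u v x y : connect (adj ([set u; v] |: F)) x y ->
  [\/ connect (adj F) x y,
      connect (adj F) x u /\ connect (adj F) v y |
      connect (adj F) x v /\ connect (adj F) u y].
Proof.
case/connectP => p; elim: p x => [|z p IH] x /=; first by move=> _ ->; apply: Or31.
case/andP => /andP[xz]; rewrite !inE => /orP[/eqP/set2_eq e|xzF] pth ly.
  case: (IH z pth ly) => [zy|[zu vy]|[zv uy]];
    case: e => -[ex ez]; subst x z.
  - by apply: Or32; rewrite connect0.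
  - by apply: Or33; rewrite connect0.
  - by apply: Or32; rewrite connect0.
  - exact: Or31.
  - exact: Or31.
  - by apply: Or33; rewrite connect0.
have c1 : connect (adj F) x z by apply: connect1; rewrite /adj xz.
case: (IH z pth ly) => [zy|[zu vy]|[zv uy]].
- by apply: Or31; apply: connect_trans zy.
- by apply: Or32; split=> //; apply: connect_trans zu.
- by apply: Or33; split=> //; apply: connect_trans zv.
Qed.

Lemma forest_sub F A : F \subset A -> forest A -> forest F.
Proof.
move=> FA /forest_bridgeP acA; apply/forest_bridgeP => x y xy xyF c.
apply: (acA x y xy); first exact: (subsetP FA).
by apply: sub_connect_adj c; apply: setSD.
Qed.

Lemma forest_add F u v : ~ connect (adj F) u v -> forest F ->
  forest ([set u; v] |: F).
Proof.
move=> Nuv /forest_bridgeP acF; apply/forest_bridgeP => x y xy.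
have [e _|ne] := eqVneq [set x; y] [set u; v].
  rewrite e => c; apply: Nuv.
  have {}c : connect (adj F) x y.
    apply: sub_connect_adj c; apply/subsetP => f; rewrite !inE.
    by case/andP => /negPf ->.
  by case/set2_eq: e => -[<- <-] //; rewrite connect_adjC.
rewrite in_setU1 (negPf ne) /= => xyF c.
have /connect_add1 : connect (adj ([set u; v] |: (F :\ [set x; y]))) x y.
  apply: sub_connect_adj c; apply/subsetP => f; rewrite !inE => /andP[-> /=].
  by [].
have sF : F :\ [set x; y] \subset F by apply: subsetDl.
have cxy : connect (adj F) x y by apply: connect1; rewrite /adj xy.
case=> [|[xu vy]|[xv uy]]; first exact: acF.
  apply: Nuv; move: (sub_connect_adj sF xu) (sub_connect_adj sF vy) => xu' vy'.
  rewrite connect_adjC in xu'; rewrite connect_adjC in vy'.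
  exact: connect_trans (connect_trans xu' cxy) vy'.
apply: Nuv; move: (sub_connect_adj sF xv) (sub_connect_adj sF uy) => xv' uy'.
rewrite connect_adjC in cxy.
exact: connect_trans (connect_trans uy' cxy) xv'.
Qed.

Variables (G : {set {set V}}) (G2 : forall f, f \in G -> #|f| = 2).

Definition cycle_bases : {set {set {set V}}} :=
  [set F | maxset (fun A => (A \subset G) && forest A) F].

Lemma cycle_basesP F : F \in cycle_bases <->
  [/\ F \subset G, forest F &
      forall x y, x != y -> [set x; y] \in G -> connect (adj F) x y].
Proof.
rewrite inE; split=> [/maxsetP[/andP[FG acF] mx]|[FG acF sp]].
  split=> // x y xy xyG; apply/negPn/negP => /negP Nc.
  have e : [set x; y] |: F = F.
    apply: mx; last exact: subsetUr.
    by rewrite subUset sub1set xyG FG forest_add.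
  by apply: Nc; apply: connect1; rewrite /adj xy -e setU11.
apply/maxsetP; split; first by rewrite FG.
move=> A /andP[AG /forest_bridgeP acA] FA; apply/eqP.
rewrite eqEsubset FA andbT; apply/subsetP => f fA; apply/negPn/negP => fF.
have /eqP/cards2P[x [y [xy ef]]] := G2 (subsetP AG _ fA); subst f.
apply: (acA x y xy fA); apply: sub_connect_adj (sp _ _ xy (subsetP AG _ fA)).
by rewrite subsetD1 FA.
Qed.

Lemma cycle_neq0 : cycle_bases != set0.
Proof.
have P0 : (set0 \subset G) && forest set0.
  by rewrite sub0set; apply/forest_bridgeP => x y _; rewrite inE.
have [F mF _] := maxset_exists (P := fun A => (A \subset G) && forest A) P0.
by apply/set0Pn; exists F; rewrite inE.
Qed.

Lemma cycle_sub F : F \in cycle_bases -> F \subset G.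
Proof. by case/cycle_basesP. Qed.

Lemma connect_cross F (S : pred V) x y : connect (adj F) x y ->
  S x -> ~~ S y -> exists u v, [/\ adj F u v, S u & ~~ S v].
Proof.
case/connectP => p; elim: p x => [|z p IH] x /=.
  by move=> _ -> ->.
case/andP => xz pth ly Sx Sy; case Sz: (S z); first exact: IH pth ly Sz Sy.
by exists x, z; rewrite Sz.
Qed.

Lemma cycle_exchange A B f : A \in cycle_bases -> B \in cycle_bases ->
  f \in A :\: B -> exists2 g, g \in B :\: A & g |: (A :\ f) \in cycle_bases.
Proof.
case/cycle_basesP => AG acA spA /cycle_basesP[BG acB spB].
rewrite inE => /andP[fB fA]; have fG := subsetP AG _ fA.
have /eqP/cards2P[x [y [xy ef]]] := G2 fG.
have Nxy : ~ connect (adj (A :\ f)) x y.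
  by rewrite ef; apply: (forest_bridgeP A).1; rewrite -?ef.
have cB : connect (adj B) x y by apply: spB; rewrite -?ef.
have [|/=|u [v [/= /andP[uv uvB] xu xv]]] :=
  @connect_cross B (connect (adj (A :\ f)) x) x y cB.
- exact: connect0.
- exact/negP.
have uvG := subsetP BG _ uvB.
have Nuv : ~ connect (adj (A :\ f)) u v.
  by move=> c; case/negP: xv; apply: connect_trans c.
have uvA : [set u; v] \notin A.
  apply/negP => h; apply: Nuv; apply: connect1; rewrite /adj uv !inE h andbT.
  by apply: contraNneq fB => <-.
have vy : connect (adj (A :\ f)) y v.
  have : connect (adj ([set x; y] |: (A :\ f))) x v.
    apply: (@connect_trans _ _ u).
      by apply: sub_connect_adj xu; apply: subsetUr.
    by rewrite -ef setD1K //; apply: spA.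
  by case/connect_add1 => [h|[_ //]|[h _]]; [rewrite h in xv | case: Nxy].
set F := [set u; v] |: (A :\ f).
have sF : A :\ f \subset F by apply: subsetUr.
have Fxy : connect (adj F) x y.
  apply: connect_trans (sub_connect_adj sF xu) _.
  apply: (@connect_trans _ _ v).
    by apply: connect1; rewrite /adj uv setU11.
  by rewrite connect_adjC; apply: sub_connect_adj vy.
exists [set u; v]; first by rewrite inE uvA.
apply/cycle_basesP; split.
- by rewrite subUset sub1set uvG (subset_trans (subsetDl _ _) AG).
- by apply: forest_add => //; apply: forest_sub acA; apply: subsetDl.
move=> a b ab abG; rewrite -/F.
have : connect (adj ([set x; y] |: (A :\ f))) a b.
  by rewrite -ef setD1K //; apply: spA.
case/connect_add1 => [c|[ax yb]|[ay xb]]; first exact: sub_connect_adj sF c.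
  apply: connect_trans (sub_connect_adj sF ax) _.
  exact: connect_trans Fxy (sub_connect_adj sF yb).
apply: connect_trans (sub_connect_adj sF ay) _.
by rewrite connect_adjC in Fxy; apply: connect_trans Fxy (sub_connect_adj sF xb).
Qed.

Definition cycle_matroid : matroid {set V} :=
  Matroid cycle_neq0 cycle_sub cycle_exchange.

End CycleMatroid.

Definition complete_graph (V : finType) : {set {set V}} :=
  [set f : {set V} | #|f| == 2].

Lemma complete_graph2 (V : finType) (f : {set V}) :
  f \in complete_graph V -> #|f| = 2.
Proof. by rewrite inE => /eqP. Qed.

Definition MK4 : matroid {set 'I_4} := cycle_matroid (@complete_graph2 'I_4).

(* Rank-3 simple matroids on the points 0, ..., n-1 whose nontrivial lines are
   those of the list ls: any three points not on a common line of ls form a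
   basis. *)
Section LineMatroid.
Variables (n : nat) (ls : seq (seq nat)).

Definition on_line (B : {set 'I_n}) (l : seq nat) :=
  [forall x in B, val x \in l].

Definition line_bases : {set {set 'I_n}} :=
  [set B : {set 'I_n} | (#|B| == 3) && ~~ has (on_line B) ls].

Hypothesis ls_ok : {in ls &, forall l l' : seq nat,
  forall a b, a != b -> a \in l -> b \in l -> a \in l' -> b \in l' -> l = l'}.
Hypothesis line_neq0 : line_bases != set0.

Lemma line_sub (B : {set 'I_n}) : B \in line_bases -> B \subset [set: 'I_n].
Proof. by rewrite subsetT. Qed.

Lemma line_exchange (A B : {set 'I_n}) x : A \in line_bases -> B \in line_bases ->
  x \in A :\: B -> exists2 y, y \in B :\: A & y |: (A :\ x) \in line_bases.
Proof.
rewrite ![_ \in line_bases]inE => /andP[/eqP A3 _] /andP[/eqP B3 Bl].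
rewrite inE => /andP[xB xA].
have /eqP/cards2P[a [b [ab eA]]] : #|A :\ x| = 2.
  by move: A3; rewrite (cardsD1 x) xA => -[].
have AB : ~~ (B \subset A).
  apply: contra xB => BA; suff /eqP -> : B == A by [].
  by rewrite eqEcard BA A3 B3.
have [/exists_inP[y yBA yl]|/exists_inPn no] :=
    boolP [exists y in B :\: A, ~~ has (on_line (y |: (A :\ x))) ls].
  exists y => //; rewrite inE yl andbT cardsU1 !inE.
  move: yBA; rewrite inE => /andP[/negPf -> _]; rewrite andbF /=.
  by move: A3; rewrite (cardsD1 x) xA => ->.
have {}no y : y \in B :\: A -> exists2 l, l \in ls &
    [/\ val y \in l, val a \in l & val b \in l].
  move=> /no; rewrite negbK => /hasP[l lls /forall_inP ol]; exists l => //.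
  by split; apply: ol; rewrite eA !inE eqxx ?orbT.
case/subsetPn: AB => y yB yA.
have [|l lls [yl al bl]] := no y; first by rewrite inE yA.
case/hasP: Bl; exists l => //; apply/forall_inP => z zB.
have [zA|zA] := boolP (z \in A); last first.
  have [|l' l'ls [zl' al' bl']] := no z; first by rewrite inE zA.
  by rewrite (ls_ok lls l'ls (a := val a) (b := val b)).
have : z \in A :\ x by rewrite !inE zA andbT; apply: contraNneq xB => <-.
by rewrite eA !inE => /orP[] /eqP ->.
Qed.

Definition line_matroid : matroid 'I_n :=
  Matroid line_neq0 line_sub line_exchange.

End LineMatroid.

Definition W3_lines := [:: [:: 0; 1; 2]; [:: 2; 3; 4]; [:: 4; 5; 0]].
Definition P6_lines := [:: [:: 0; 1; 2]].
Definition Q6_lines := [:: [:: 0; 1; 2]; [:: 2; 3; 4]].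

Definition lines_okb (ls : seq (seq nat)) :=
  all (fun l : seq nat => all (fun l' : seq nat =>
    all (fun a => all (fun b =>
      (a != b) ==> (a \in l') ==> (b \in l') ==> (l == l')) l) l) ls) ls.

Lemma lines_okP ls : lines_okb ls -> {in ls &, forall l l' : seq nat,
  forall a b, a != b -> a \in l -> b \in l -> a \in l' -> b \in l' -> l = l'}.
Proof.
move=> ok l l' ll ll' a b ab al bl al' bl'.
move/allP/(_ _ ll)/allP/(_ _ ll')/allP/(_ _ al)/allP/(_ _ bl): ok.
by rewrite ab al' bl' => /eqP.
Qed.

Lemma line_bases6_neq0 ls :
  ~~ has (fun l : seq nat => [&& 0 \in l, 1 \in l & 3 \in l]) ls ->
  line_bases 6 ls != set0.
Proof.
move=> h; pose i k (lt : k < 6) : 'I_6 := Ordinal lt.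
apply/set0Pn; exists [set i 0 isT; i 1 isT; i 3 isT].
rewrite inE setUC cardsU1 cards2 !inE /=; apply: contra h => /hasP[l lls ol].
apply/hasP; exists l => //; move/forall_inP: ol => ol.
by rewrite (ol (i 0 isT)) ?(ol (i 1 isT)) ?(ol (i 3 isT)) // !inE eqxx ?orbT.
Qed.

Definition W3 : matroid 'I_6 :=
  line_matroid (@lines_okP W3_lines isT) (@line_bases6_neq0 W3_lines isT).
Definition P6 : matroid 'I_6 :=
  line_matroid (@lines_okP P6_lines isT) (@line_bases6_neq0 P6_lines isT).
Definition Q6 : matroid 'I_6 :=
  line_matroid (@lines_okP Q6_lines isT) (@line_bases6_neq0 Q6_lines isT).

Local Open Scope ring_scope.

Section ToricIdeal.
Variables (K : fieldType) (T : finType) (M : matroid T).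

(* The variable 'X_j of the source is attached to the basis [enum_val j], and
   the variable 'X_i of the target to the ground element [enum_val i]. *)
Definition toric_monomial (j : 'I_#|mbases M|) : {mpoly K[#|mground M|]} :=
  \prod_(i < #|mground M| | enum_val i \in enum_val j) 'X_i.

Definition toric_map (p : {mpoly K[#|mbases M|]}) : {mpoly K[#|mground M|]} :=
  p \mPo [tuple toric_monomial j | j < #|mbases M|].

Definition toric_ideal (p : {mpoly K[#|mbases M|]}) : Prop := toric_map p = 0.

End ToricIdeal.

Arguments toric_ideal K {T} M p.

Section Groebner.
Variables (K : fieldType) (n : nat).
Implicit Types (ord : rel 'X_{1..n}) (I : {mpoly K[n]} -> Prop).

Definition monomial_order ord : Prop :=
  [/\ reflexive ord, antisymmetric ord, transitive ord, total ord &
      (forall m, ord 0%MM m) /\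
      (forall m1 m2 m, ord m1 m2 -> ord (m1 + m)%MM (m2 + m)%MM)].

(* The library's [mlead] is relative to one fixed monomial order. *)
Definition is_lead ord (p : {mpoly K[n]}) (m : 'X_{1..n}) : Prop :=
  m \in msupp p /\ {in msupp p, forall m', ord m' m}.

Definition ideal_span (S : {mpoly K[n]} -> Prop) (p : {mpoly K[n]}) : Prop :=
  exists2 s : seq ({mpoly K[n]} * {mpoly K[n]}),
    forall c, c \in s -> S c.2 & p = \sum_(c <- s) c.1 * c.2.

Definition initial_ideal ord I : {mpoly K[n]} -> Prop :=
  ideal_span (fun q => exists p m, [/\ I p, is_lead ord p m & q = 'X_[m]]).

Definition groebner_basis ord I (G : seq {mpoly K[n]}) : Prop :=
  (forall g, g \in G -> I g) /\
  (forall p, initial_ideal ord I p <-> initial_ideal ord (fun g => g \in G) p).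

Definition quadratic_binomial (g : {mpoly K[n]}) : Prop :=
  exists u v : 'X_{1..n},
    [/\ u != v, mdeg u = 2%N, mdeg v = 2%N & g = 'X_[u] - 'X_[v]].

End Groebner.

(* Main.v *)
Require Import Defs.
From mathcomp Require Import all_boot all_order all_algebra.
From mathcomp Require Import mpoly zify.

(** If a nonuniform matroid has no 1- or 2-separation, take a circuit C inside
    a nonspanning hyperplane H and put D = E \ H. By Tutte's linking argument
    one can delete or contract all elements outside C and D while keeping C a
    circuit, D a cocircuit and the connectivity between them at least 2;
    shrinking C and D then leaves a rank-3 matroid on 6 points with a
    circuit-hyperplane whose complement is a basis. These are precisely P6, Q6,
    W^3 and M(K4). So a matroid without those minors is built from uniform
    matroids by direct sums and 2-sums.

    Call M sortable along an ordering of E if for any two bases A and B the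
    multiset union of A and B is also that of two bases that alternate along
    the ordering. Uniform matroids are sortable, the property is invariant under
    rotating the order, and it passes to direct sums and 2-sums by concatenating
    orders that are cut at the basepoint.

    For a sortable M, weigh a basis B by the sum over all intervals I of the
    squares |B ∩ I|^2. A monomial whose bases pairwise alternate minimizes the
    weight in its fiber and is the only such monomial there, while replacing a
    nonalternating pair by its sorted version lowers the weight. Hence the
    quadratic binomials of the ideal form a Gröbner basis for any monomial order
    refining the weight. *)

Set Implicit Arguments.
Unset Strict Implicit.
Unset Printing Implicit Defensive.

Import GRing.Theory.

(** * Rank functions and minors *)

Section Rank.
Variables (T : finType) (M : matroid T).
Implicit Types (A B C X Y Z : {set T}) (e x : T).

Definition rk A := \max_(B in mbases M) #|A :&: B|.

Lemma basis_card A B : A \in mbases M -> B \in mbases M -> #|A| = #|B|.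
Proof.
move: {2}#|A :\: B|.+1 (ltnSn #|A :\: B|) => n.
elim: n A => // n IH A AB AM BM.
have [AB0|/set0Pn[x xAB]] := eqVneq (A :\: B) set0.
  have sAB : A \subset B by rewrite -setD_eq0 AB0.
  suff -> : A = B by [].
  apply/eqP; rewrite eqEsubset sAB -setD_eq0 /=.
  apply/negPn/negP => /set0Pn[x /(mbases_exchange BM AM)[y]].
  by rewrite AB0 inE.
have [y yBA A'M] := mbases_exchange AM BM xAB.
move: xAB yBA; rewrite !inE => /andP[xB xA] /andP[yA yB].
rewrite -(IH _ _ A'M BM).
  by rewrite cardsU1 !inE (negPf yA) andbF [in LHS](cardsD1 x) xA.
apply: leq_trans (_ : #|A :\: B| <= n); last by rewrite -ltnS.
rewrite [in X in _ < X](cardsD1 x) inE xA xB /= ltnS.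
apply: subset_leq_card; apply/subsetP => z; rewrite !inE.
case: eqVneq => [->|_] /=; first by rewrite yB.
by case: (z == x); case: (z \in A); case: (z \in B).
Qed.

Lemma rk_le_basis A B : B \in mbases M -> #|A :&: B| <= rk A.
Proof. exact: leq_bigmax_cond. Qed.

Lemma rk_basis A : exists2 B, B \in mbases M & rk A = #|A :&: B|.
Proof.
have [|B BM eB] := @eq_bigmax_cond _ (mem (mbases M)) (fun B => #|A :&: B|).
  by rewrite card_gt0; apply: mbases_neq0.
by exists B.
Qed.

Lemma rkS A B : A \subset B -> rk A <= rk B.
Proof.
move=> sAB; have [C CM ->] := rk_basis A.
by apply: leq_trans (rk_le_basis B CM); apply: subset_leq_card; apply: setSI.
Qed.

Lemma rk_card A : rk A <= #|A|.
Proof. by have [C CM ->] := rk_basis A; apply/subset_leq_card/subsetIl. Qed.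

Lemma rk0 : rk set0 = 0.
Proof. by apply/eqP; rewrite -leqn0 -(cards0 T) rk_card. Qed.

Lemma rk_ground_basis B : B \in mbases M -> rk (mground M) = #|B|.
Proof.
move=> BM; have [C CM ->] := rk_basis (mground M).
by rewrite (setIidPr (mbases_sub CM)) (basis_card CM BM).
Qed.

Lemma rk_le_ground A : rk A <= rk (mground M).
Proof.
have [C CM ->] := rk_basis A; rewrite (rk_ground_basis CM).
exact/subset_leq_card/subsetIr.
Qed.

(* Choosing the second basis to overlap as much as possible with one that is
   optimal for Y, an exchange that removes an element outside Y improves it. *)
Lemma rk_chain X Y : X \subset Y ->
  exists2 B, B \in mbases M & rk X = #|X :&: B| /\ rk Y = #|Y :&: B|.
Proof.
move=> sXY; have [B2 B2M eY] := rk_basis Y; have [B0 B0M eX0] := rk_basis X.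
pose P B := (B \in mbases M) && (#|X :&: B| == rk X).
have P0 : P B0 by rewrite /P B0M eX0 eqxx.
have [B /andP[BM /eqP eX] mB] :=
  @arg_maxnP _ B0 P (fun B => #|Y :&: B| + #|B :&: B2|) P0.
exists B => //; split=> //.
apply/eqP; rewrite eqn_leq rk_le_basis // andbT leqNgt; apply/negP => ltY.
have /subsetPn[x xB xB2] : ~~ (B :\: Y \subset B2 :\: Y).
  apply/negP => /subset_leq_card; 
  have := cardsID Y B; have := cardsID Y B2; rewrite ![_ :&: Y]setIC.
  have := basis_card BM B2M; lia.
move: xB xB2; rewrite !inE => /andP[xY xB]; rewrite xY /= => xB2.
have xBB2 : x \in B :\: B2 by rewrite inE xB xB2.
have [y] := mbases_exchange BM B2M xBB2; rewrite inE => /andP[yB yB2] B'M.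
have xX : x \notin X by apply: contra xY; apply: (subsetP sXY).
have sub Z : x \notin Z -> Z :&: B \subset Z :&: (y |: B :\ x).
  move=> xZ; apply/subsetP => z; rewrite !inE => /andP[zZ ->].
  rewrite zZ andbT /=; apply/orP; right; apply: contraNneq xZ => <- //.
have P' : P (y |: B :\ x).
  rewrite /P B'M eqn_leq rk_le_basis //= -eX.
  exact/subset_leq_card/sub.
have leY : #|Y :&: B| <= #|Y :&: (y |: B :\ x)| by exact/subset_leq_card/sub.
move: (mB _ P'); apply/negP; have -> : (y |: B :\ x) :&: B2 = y |: (B :&: B2).
  apply/setP => z; rewrite !inE; case: (eqVneq z y) => [->|_] /=; first by [].
  by case: (eqVneq z x) => [->|] //=; rewrite (negPf xB2) andbF.
rewrite cardsU1 inE (negPf yB) add1n addnS -ltnNge ltnS.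
by rewrite leq_add2r.
Qed.

Lemma rk_submod A B : rk (A :|: B) + rk (A :&: B) <= rk A + rk B.
Proof.
have [|C CM [-> ->]] := @rk_chain (A :&: B) (A :|: B).
  exact: subset_trans (subsetIl _ _) (subsetUl _ _).
apply: leq_trans (leq_add (rk_le_basis A CM) (rk_le_basis B CM)).
by rewrite setIUl setIIl cardsUI.
Qed.

Lemma rk_le_diff A B : A \subset B -> rk B <= rk A + #|B :\: A|.
Proof.
move=> sAB; have := rk_submod A (B :\: A); have := rk_card (B :\: A).
by rewrite setDE setUIr setUCr setIT (setUidPr sAB); lia.
Qed.

Lemma rkU1_le A x : rk (x |: A) <= (rk A).+1.
Proof.
apply: leq_trans (rk_le_diff (subsetUr _ _)) _.
rewrite -addn1 leq_add2l; apply: leq_trans (_ : #|[set x]| <= _).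
  apply/subset_leq_card/subsetP => z; rewrite !inE.
  by case: (z == x); case: (z \in A).
by rewrite cards1.
Qed.

Lemma rkU1_ge A x : rk A <= rk (x |: A).
Proof. exact/rkS/subsetUr. Qed.

Lemma rkU1 A x : rk (x |: A) = rk A \/ rk (x |: A) = (rk A).+1.
Proof. by have := rkU1_le A x; have := rkU1_ge A x; lia. Qed.

Lemma indep_sub A B : A \subset B -> rk B = #|B| -> rk A = #|A|.
Proof.
move=> sAB; have := rk_le_diff sAB; have := rk_card A.
by rewrite cardsD (setIidPr sAB); have := subset_leq_card sAB; lia.
Qed.

Lemma rk_spanS A B x : A \subset B -> rk (x |: A) = rk A -> rk (x |: B) = rk B.
Proof.
move=> sAB eA; have := rk_submod (x |: A) B.
rewrite -setUA (setUidPr sAB) => h.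
have : rk A <= rk ((x |: A) :&: B).
  by apply: rkS; rewrite subsetI subsetUr sAB.
have := rkU1_ge B x; lia.
Qed.

Lemma rk_span A B : (forall x, x \in B -> rk (x |: A) = rk A) ->
  rk (B :|: A) = rk A.
Proof.
move: {2}#|B| (leqnn #|B|) => n; elim: n B => [|n IH] B.
  by rewrite leqn0 cards_eq0 => /eqP -> _; rewrite set0U.
have [->|/set0Pn[x xB]] := eqVneq B set0; first by rewrite set0U.
rewrite (cardsD1 x) xB /= add1n ltnS => cB h.
rewrite -(setD1K xB) -setUA (rk_spanS (subsetUr _ _) (h x xB)) IH //.
by move=> y; rewrite inE => /andP[_ /h].
Qed.

Lemma rk_augment A B : rk A < rk B -> exists2 x, x \in B & rk (x |: A) = (rk A).+1.
Proof.
move=> lAB; have [/exists_inP[x xB /eqP h]|/exists_inPn h] :=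
  boolP [exists x in B, rk (x |: A) == (rk A).+1]; first by exists x.
have eA : rk (B :|: A) = rk A.
  by apply: rk_span => x /h; case: (rkU1 A x) => // ->; rewrite eqxx.
by have := rkS (subsetUl B A); rewrite eA leqNgt lAB.
Qed.

Lemma mbasesE B : (B \in mbases M) =
  [&& B \subset mground M, #|B| == rk (mground M) & rk B == rk (mground M)].
Proof.
apply/idP/and3P => [BM|[_ /eqP cB /eqP rB]].
  rewrite mbases_sub // (rk_ground_basis BM) eqxx; split=> //.
  rewrite eqn_leq rk_card /=; apply: leq_trans (rk_le_basis B BM).
  by rewrite setIid.
have [C CM eC] := rk_basis B.
have sBC : B \subset C.
  by apply/setIidPl/eqP; rewrite eqEcard subsetIl -eC rB cB /=.
suff -> : B = C by [].
by apply/eqP; rewrite eqEcard sBC cB (rk_ground_basis CM) /= leqnn.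
Qed.

Lemma basis_in A : A \subset mground M ->
  exists B, [/\ B \subset A, rk B = #|B| & #|B| = rk A].
Proof.
move=> sA; have [C CM eC] := rk_basis A; exists (A :&: C).
split=> //; first exact: subsetIl.
by apply: indep_sub (subsetIr A C) _; move: CM;
  rewrite mbasesE => /and3P[_ /eqP -> /eqP].
Qed.

Lemma indep_extend A B : A \subset B -> rk A = #|A| ->
  exists C, [/\ A \subset C, C \subset B, rk C = #|C| & #|C| = rk B].
Proof.
move=> sAB iA; have [D DM [eA eB]] := rk_chain sAB; exists (B :&: D); split.
- have /eqP <- : A :&: D == A by rewrite eqEcard subsetIl -eA iA leqnn.
  exact: setSI.
- exact: subsetIl.
- by apply: indep_sub (subsetIr B D) _; move: DM;
  rewrite mbasesE => /and3P[_ /eqP -> /eqP].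
- by rewrite eB.
Qed.

End Rank.

Section MinorRank.
Variables (T : finType) (M : matroid T) (e : T).
Implicit Types A B : {set T}.

Lemma rk_mdel A : e \notin A -> rk (mdel M e) A = rk M A.
Proof.
move=> eA; have capD B : A :&: (B :\ e) = A :&: B.
  apply/setP => z; rewrite !inE; case: (eqVneq z e) => [->|] //=.
  by rewrite (negPf eA).
apply/eqP; rewrite eqn_leq; apply/andP; split.
  have [B] := rk_basis (mdel M e) A; rewrite /= /del_bases.
  case: ifP => _; last by rewrite inE => /andP[BM _] ->; apply: rk_le_basis.
  by case/imsetP => C; rewrite inE => /andP[CM _] -> ->; rewrite capD rk_le_basis.
have [co|nco] := boolP (mcoloop M e).
  have [B BM ->] := rk_basis M A; rewrite -capD; apply: rk_le_basis.
  rewrite /= /del_bases co; apply/imsetP; exists B => //.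
  by rewrite inE BM; apply: (forall_inP co).
have /set0Pn[B0] := avoid_neq0 nco; rewrite inE => /andP[B0M eB0].
have [|B BM [-> eY]] := @rk_chain _ M A (~: [set e]).
  by apply/subsetP => z zA; rewrite !inE; apply: contraNneq eA => <-.
apply: rk_le_basis; rewrite /= /del_bases (negPf nco) inE BM /=.
have : #|B0| <= rk M (~: [set e]).
  apply: leq_trans (rk_le_basis _ B0M).
  suff -> : ~: [set e] :&: B0 = B0 by [].
  apply/setP => z; rewrite !inE; case: (eqVneq z e) => [->|] //=.
  by rewrite (negPf eB0).
rewrite eY (basis_card B0M BM) => h; apply: contraL h => eB; rewrite -ltnNge.
by rewrite [in ltnRHS](cardsD1 e) eB add1n ltnS setIC -setDE.
Qed.

Lemma rk1_loop : rk M [set e] = ~~ mloop M e.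
Proof.
have [lo|nlo] := boolP (mloop M e).
  have [B BM ->] := rk_basis M [set e].
  apply/eqP; rewrite cards_eq0; apply/eqP/setP => z; rewrite !inE.
  by case: eqVneq => [->|] //=; apply/negbTE/(forall_inP lo).
have /forall_inPn[B BM /negPn eB] := nlo.
apply/eqP; rewrite eqn_leq; apply/andP; split;
  first by rewrite /= -[X in _ <= X](cards1 e) rk_card.
apply: leq_trans (rk_le_basis _ BM).
by rewrite (setIidPl _) ?cards1 // sub1set.
Qed.

Lemma rk_mcontr A : e \notin A -> rk M (e |: A) = rk (mcontr M e) A + rk M [set e].
Proof.
move=> eA; have capD B : A :&: (B :\ e) = A :&: B.
  apply/setP => z; rewrite !inE; case: (eqVneq z e) => [->|] //=.
  by rewrite (negPf eA).
have capU B : e \in B -> #|(e |: A) :&: B| = (#|A :&: B|).+1.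
  move=> eB; rewrite -add1n -(_ : (e \notin A :&: B) = 1 :> nat).
    by rewrite -cardsU1 setIUl (setIidPl _) // sub1set.
  by rewrite inE (negPf eA).
rewrite rk1_loop; case: (boolP (mloop M e)) => [lo|nlo] /=.
  rewrite addn0 [LHS]/rk [RHS]/rk /= /contr_bases lo.
  apply: eq_big => [B|B BM].
    by rewrite inE; case BM: (B \in _) => //=; rewrite (forall_inP lo).
  congr #|pred_of_set _|; apply/setP => z; rewrite !inE.
  by case: eqVneq => [->|] //=; rewrite (negPf eA) (negPf (forall_inP lo _ BM)).
apply/eqP; rewrite addn1 eqn_leq; apply/andP; split.
  have [|B BM [e1 eY]] := @rk_chain _ M [set e] (e |: A).
    by rewrite sub1set setU11.
  have eB : e \in B.
    move: e1; rewrite rk1_loop nlo => /esym/eqP/cards1P[x ex].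
    by have := set11 x; rewrite -ex !inE => /andP[/eqP <-].
  rewrite eY capU // ltnS -capD; apply: rk_le_basis.
  rewrite /= /contr_bases (negPf nlo); apply/imsetP; exists B => //.
  by rewrite inE BM.
have [B] := rk_basis (mcontr M e) A; rewrite /= /contr_bases (negPf nlo).
case/imsetP => C; rewrite inE => /andP[CM eC] -> ->.
by rewrite capD -capU // rk_le_basis.
Qed.

End MinorRank.

Lemma is_minor_trans (T : finType) (M N P : matroid T) :
  is_minor M N -> is_minor N P -> is_minor M P.
Proof. by move=> MN; elim=> // Q e _ MQ eQ;
  [apply: minor_del | apply: minor_contr]. Qed.

Lemma has_minor_trans (T U : finType) (M N : matroid T) (P : matroid U) :
  is_minor M N -> has_minor N P -> has_minor M P.
Proof. by move=> MN [Q NQ iso]; exists Q => //; apply: is_minor_trans NQ. Qed.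

Lemma minor_deletion (T : finType) (M : matroid T) (Z : {set T}) :
  Z \subset mground M -> exists N, [/\ is_minor M N, mground N = Z &
    forall A : {set T}, A \subset Z -> rk N A = rk M A].
Proof.
move: {2}#|mground M :\: Z| (leqnn #|mground M :\: Z|) => n.
elim: n M => [|n IH] M.
  rewrite leqn0 cards_eq0 setD_eq0 => s1 s2; exists M; split=> //.
    exact: minor_refl.
  by apply/eqP; rewrite eqEsubset s1.
have [/eqP|/set0Pn[e eD]] := eqVneq (mground M :\: Z) set0.
  rewrite setD_eq0 => s1 _ s2; exists M; split=> //; first exact: minor_refl.
  by apply/eqP; rewrite eqEsubset s1.
rewrite (cardsD1 e) eD add1n ltnS; move: eD; rewrite inE => /andP[eZ eM] c sZ.
have [||N [MN gN rN]] := IH (mdel M e).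
- by apply: leq_trans c; apply/subset_leq_card/subsetP => z;
  rewrite !inE => /and3P[-> -> ->].
- by rewrite /= subsetD1 sZ.
exists N; split=> //.
  by apply: is_minor_trans MN; apply: minor_del => //; apply: minor_refl.
move=> A sA; rewrite rN // rk_mdel //.
by apply: contra eZ; apply: (subsetP sA).
Qed.

Lemma minor_contraction (T : finType) (M : matroid T) (X : {set T}) :
  X \subset mground M -> exists N, [/\ is_minor M N, mground N = mground M :\: X &
    forall A : {set T}, A \subset mground M :\: X -> rk M (X :|: A) = rk N A + rk M X].
Proof.
move: {2}#|X| (leqnn #|X|) => n.
elim: n M X => [|n IH] M X.
  rewrite leqn0 cards_eq0 => /eqP -> _; exists M; split=> //.
  - exact: minor_refl.
  - by rewrite setD0.
  - by move=> A _; rewrite set0U rk0 addn0.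
have [->|/set0Pn[e eX]] := eqVneq X set0.
  by move=> _ _; apply: IH; rewrite ?cards0 ?sub0set.
rewrite (cardsD1 e) eX add1n ltnS => c sX.
have eM := subsetP sX _ eX.
have [||N [MN gN rN]] := IH (mcontr M e) (X :\ e) => //.
  exact: setSD.
have eG : mground (mcontr M e) :\: (X :\ e) = mground M :\: X.
  apply/setP => z; rewrite !inE; case: (eqVneq z e) => [->|] //=.
  by rewrite eX.
rewrite eG in gN rN.
exists N; split=> //.
  by apply: is_minor_trans MN; apply: minor_contr => //; apply: minor_refl.
move=> A sA; have := rN A sA.
have eA : e \notin A.
  by apply/negP => /(subsetP sA); rewrite inE eX.
have := @rk_mcontr _ M e (X :\ e :|: A); rewrite setUA setD1K //.
have := @rk_mcontr _ M e (X :\ e); rewrite setD1K //.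
rewrite !inE eqxx /= eA; lia.
Qed.

Lemma minor_exists (T : finType) (M : matroid T) (X Z : {set T}) :
  X \subset mground M -> Z \subset mground M :\: X ->
  exists N, [/\ is_minor M N, mground N = Z &
    forall A : {set T}, A \subset Z -> rk M (X :|: A) = rk N A + rk M X].
Proof.
move=> /minor_contraction[N [MN gN rN]] sZ.
have [|P [NP gP rP]] := @minor_deletion _ N Z; first by rewrite gN.
exists P; split=> //; first exact: is_minor_trans NP.
by move=> A sA; rewrite rP // rN // (subset_trans sA).
Qed.

(** * Sortable matroids *)

Section Sortable.
Variable T : finType.
Implicit Types (A B : {set T}) (s : seq T).

Definition cnt s A i := count (mem A) (take i s).

(* The merged sequence of A and B, listed along s, alternates between A and B,
   starting with A; an element of both sets occurs there twice in a row. *)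
Definition interlaced s A B := forall i, cnt s B i <= cnt s A i <= (cnt s B i).+1.

Definition sortable (M : matroid T) s := [/\ uniq s, s =i mground M &
  forall A B, A \in mbases M -> B \in mbases M -> exists A' B',
    [/\ A' \in mbases M, B' \in mbases M,
        forall x, (x \in A') + (x \in B') = (x \in A) + (x \in B)
      & interlaced s A' B']].

Lemma cnt_cat s1 s2 A i :
  cnt (s1 ++ s2) A i = cnt s1 A i + cnt s2 A (i - size s1).
Proof.
rewrite /cnt take_cat; case: ltnP => h.
  by rewrite (_ : i - size s1 = 0) ?take0 ?addn0 //; apply/eqP; rewrite subn_eq0 ltnW.
by rewrite count_cat [take i s1]take_oversize.
Qed.

Lemma cnt_oversize s A i : size s <= i -> cnt s A i = cnt s A (size s).
Proof. by move=> h; rewrite /cnt !take_oversize. Qed.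

Lemma cnt0 s A : cnt s A 0 = 0.
Proof. by rewrite /cnt take0. Qed.

Lemma cnt_seq1 x A i : 0 < i -> cnt [:: x] A i = (x \in A).
Proof. by case: i => // i _; rewrite /cnt /= addn0. Qed.

Lemma cnt_size s A : uniq s -> {subset A <= s} -> cnt s A (size s) = #|A|.
Proof.
move=> us sA; rewrite /cnt take_size -size_filter -(card_uniqP (filter_uniq _ us)).
apply: eq_card => x; rewrite mem_filter.
by apply: andb_idr => /sA.
Qed.

Lemma eq_in_cnt s A B i : {in s, A =i B} -> cnt s A i = cnt s B i.
Proof. by move=> h; apply: eq_in_count => x /mem_take/h. Qed.

Lemma cntU s A1 A2 i : [disjoint A1 & A2] ->
  cnt s (A1 :|: A2) i = cnt s A1 i + cnt s A2 i.
Proof.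
move=> d; rewrite /cnt -count_predUI; rewrite [X in _ = _ + X](_ : _ = 0) ?addn0.
  by apply: eq_count => x; rewrite /= !inE.
apply/eqP; rewrite -leqn0 leqNgt -has_count; apply/hasPn => x _ /=.
by apply/negP => /andP[/(disjointFr d) ->].
Qed.

Lemma sortable_rot M s1 s2 : sortable M (s1 ++ s2) -> sortable M (s2 ++ s1).
Proof.
case=> us gs h; split.
- by rewrite uniq_catC.
- by move=> x; rewrite mem_cat orbC -mem_cat gs.
move=> A B AM BM; have [A' [B' [A'M B'M eq il]]] := h A B AM BM.
have tot : cnt (s1 ++ s2) A' (size (s1 ++ s2)) = cnt (s1 ++ s2) B' (size (s1 ++ s2)).
  rewrite !cnt_size // ?(basis_card A'M B'M) //.
    by move=> x; rewrite gs; apply/subsetP/mbases_sub.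
  by move=> x; rewrite gs; apply/subsetP/mbases_sub.
have key i : exists j, cnt (s2 ++ s1) A' i + cnt s1 A' (size s1) + cnt (s1 ++ s2) B' j
    = cnt (s2 ++ s1) B' i + cnt s1 B' (size s1) + cnt (s1 ++ s2) A' j.
  move: tot; rewrite !cnt_cat size_cat addKn.
  rewrite (@cnt_oversize s1 _ (_ + _)) ?leq_addr //.
  rewrite (@cnt_oversize s1 _ (_ + _)) ?leq_addr // => tot.
  case: (leqP i (size s2)) => hi.
    exists (size s1 + i); rewrite !cnt_cat addKn (eqP hi) !cnt0.
    rewrite ![cnt s1 _ (size s1 + i)]cnt_oversize ?leq_addr //; lia.
  exists (minn (i - size s2) (size s1)); rewrite !cnt_cat.
  rewrite ![cnt s2 _ i]cnt_oversize 1?ltnW // (eqP (geq_minr _ _)) !cnt0.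
  have e A0 : cnt s1 A0 (minn (i - size s2) (size s1)) = cnt s1 A0 (i - size s2).
    case: leqP => // h1; rewrite [RHS]cnt_oversize // ltnW //.
  rewrite !e; lia.
have [h1|h1] := leqP (cnt s1 A' (size s1)) (cnt s1 B' (size s1)).
  exists A', B'; split=> // i; have [j ej] := key i.
  have := il j; have := il (size s1).
  by rewrite !cnt_cat subnn !cnt0 !addn0 in ej *; lia.
exists B', A'; split=> //; first by move=> x; rewrite addnC eq.
move=> i; have [j ej] := key i.
have := il j; have := il (size s1).
by rewrite !cnt_cat subnn !cnt0 !addn0 in ej *; lia.
Qed.

Lemma sortable_uniform M :
  (forall A, A \subset mground M -> #|A| = rk M (mground M) -> A \in mbases M) ->
  exists s, sortable M s.
Proof.
move=> unif; exists (enum (mground M)).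
set s := enum _; have us : uniq s by apply: enum_uniq.
have gs : s =i mground M by move=> x; rewrite mem_enum.
split=> // A B AM BM.
pose D := (A :\: B) :|: (B :\: A).
pose par x := odd (cnt s D (index x s)).
pose A' := [set x in A :|: B | (x \in A :&: B) || ~~ par x].
pose B' := [set x in A :|: B | (x \in A :&: B) || par x].
have sA := subsetP (mbases_sub AM); have sB := subsetP (mbases_sub BM).
have key i : i <= size s -> cnt s A' i = cnt s B' i + odd (cnt s D i).
  elim: i => [|i IH] hi; first by rewrite !cnt0.
  have x0 : T by case: (s) hi => [|x].
  have step C : cnt s C i.+1 = cnt s C i + (nth x0 s i \in C).
    by rewrite /cnt (take_nth x0) // -cats1 count_cat /= addn0.
  rewrite !step oddD IH 1?ltnW //.
  set x := nth x0 s i; have ex : index x s = i by rewrite index_uniq.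
  rewrite !inE /par ex.
  by case: (x \in A); case: (x \in B); case: (odd _) => /=; lia.
have sumE x : (x \in A') + (x \in B') = (x \in A) + (x \in B).
  by rewrite !inE; case: (x \in A); case: (x \in B); case: (par x).
have A'E : A' \subset mground M.
  by apply/subsetP => x; rewrite !inE => /andP[/orP[/sA|/sB]].
have B'E : B' \subset mground M.
  by apply/subsetP => x; rewrite !inE => /andP[/orP[/sA|/sB]].
have cD : odd #|D| = false.
  have := cardsUI (A :\: B) (B :\: A).
  have -> : (A :\: B) :&: (B :\: A) = set0.
    by apply/setP => x; rewrite !inE; case: (x \in A); case: (x \in B).
  rewrite cards0 addn0 -/D => ->; have := cardsID B A; have := cardsID A B.
  rewrite setIC (basis_card AM BM) => <- /addnI ->.
  by rewrite addnn odd_double.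
have sum_card (C E : {set T}) : #|C| + #|E| = \sum_x ((x \in C) + (x \in E)).
  rewrite -!sum1_card ![\sum_(_ in _) _]big_mkcond -big_split; apply: eq_bigr => x _.
  by case: (x \in C); case: (x \in E).
have sD : {subset D <= s}.
  by move=> x; rewrite gs !inE => /orP[] /andP[_]; [apply: sA | apply: sB].
have eqc : #|A'| = #|B'|.
  have := key _ (leqnn _); rewrite !cnt_size ?cD ?addn0 //.
  - by move=> x; rewrite gs; apply/subsetP.
  - by move=> x; rewrite gs; apply/subsetP.
have eqs : #|A'| + #|B'| = #|A| + #|B|.
  by rewrite !sum_card; apply: eq_bigr => x _; apply: sumE.
have cB := rk_ground_basis BM; have cAB := basis_card AM BM.
exists A', B'; split=> //; try by apply: unif => //; rewrite cB; lia.
move=> i; case: (leqP i (size s)) => hi; last first.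
  rewrite !(@cnt_oversize s _ i) ?(ltnW hi) // key //.
  by rewrite (@cnt_size s D) // cD addn0 leqnn leqnSn.
by rewrite key //; case: odd; lia.
Qed.

Lemma sortable_direct_sum (M M1 M2 : matroid T) s1 s2 :
  sortable M1 s1 -> sortable M2 s2 ->
  [disjoint mground M1 & mground M2] ->
  mground M = mground M1 :|: mground M2 ->
  (forall B1 B2, B1 \subset mground M1 -> B2 \subset mground M2 ->
     (B1 :|: B2 \in mbases M) = (B1 \in mbases M1) && (B2 \in mbases M2)) ->
  sortable M (s1 ++ s2).
Proof.
case=> us1 gs1 h1 [us2 gs2 h2] dis gM bM; split.
- rewrite cat_uniq us1 us2 andbT; apply/hasPn => x; rewrite gs1 gs2 => x2.
  by rewrite (disjointFl dis x2).
- by move=> x; rewrite mem_cat gs1 gs2 gM inE.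
have split B : B \in mbases M ->
    B :&: mground M1 \in mbases M1 /\ B :&: mground M2 \in mbases M2.
  move=> BM; apply/andP; rewrite -bM ?subsetIr // -setIUr -gM.
  by rewrite (setIidPl (mbases_sub BM)).
move=> A B AM BM; have [A1 A2] := split _ AM; have [B1 B2] := split _ BM.
have [X1 [Y1 [X1M Y1M e1 il1]]] := h1 _ _ A1 B1.
have [X2 [Y2 [X2M Y2M e2 il2]]] := h2 _ _ A2 B2.
have sX1 := mbases_sub X1M; have sX2 := mbases_sub X2M.
have sY1 := mbases_sub Y1M; have sY2 := mbases_sub Y2M.
exists (X1 :|: X2), (Y1 :|: Y2); split.
- by rewrite bM // X1M.
- by rewrite bM // Y1M.
- move=> x; rewrite !inE; move: (e1 x) (e2 x); rewrite !inE.
  have sub (C D : {set T}) : C \subset D -> (x \in C) ==> (x \in D).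
    by move=> /subsetP h; apply/implyP/h.
  move: (sub _ _ sX1) (sub _ _ sX2) (sub _ _ sY1) (sub _ _ sY2).
  move: (sub _ _ (mbases_sub AM)) (sub _ _ (mbases_sub BM)); rewrite gM inE.
  have : ~~ ((x \in mground M1) && (x \in mground M2)).
    by apply/negP => /andP[/(disjointFr dis) ->].
  case: (x \in mground M1); case: (x \in mground M2) => //;
  by case: (x \in X1); case: (x \in X2); case: (x \in Y1); case: (x \in Y2) => //=;
    case: (x \in A); case: (x \in B).
have dX : [disjoint X1 & X2] by apply: disjointWl sX1 (disjointWr sX2 dis).
have dY : [disjoint Y1 & Y2] by apply: disjointWl sY1 (disjointWr sY2 dis).
have z12 A0 i : A0 \subset mground M1 -> cnt s2 A0 i = 0.
  move=> sA; rewrite -[RHS](_ : cnt s2 set0 i = 0).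
    apply: eq_in_cnt => x; rewrite gs2 inE => x2.
    by apply/negbTE/negP => /(subsetP sA); rewrite (disjointFl dis x2).
  by rewrite /cnt (eq_count (a2 := pred0)) ?count_pred0 // => x; rewrite /= inE.
have z21 A0 i : A0 \subset mground M2 -> cnt s1 A0 i = 0.
  move=> sA; rewrite -[RHS](_ : cnt s1 set0 i = 0).
    apply: eq_in_cnt => x; rewrite gs1 inE => x2.
    by apply/negbTE/negP => /(subsetP sA); rewrite (disjointFr dis x2).
  by rewrite /cnt (eq_count (a2 := pred0)) ?count_pred0 // => x; rewrite /= inE.
move=> i; rewrite !cnt_cat !cntU // (z12 X1) // (z12 Y1) // (z21 X2) // (z21 Y2) //
  !addn0 !add0n.
have [hi|hi] := leqP i (size s1); first by rewrite (eqP hi) !cnt0 !addn0; apply: il1.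
rewrite !(@cnt_oversize s1 _ i) ?(ltnW hi) // !cnt_size //.
- by rewrite (basis_card X1M Y1M) -addnS !leq_add2l; apply: il2.
- by move=> x; rewrite gs1; apply/subsetP.
- by move=> x; rewrite gs1; apply/subsetP.
Qed.

Lemma sortable_2sum (M M1 M2 : matroid T) s1 s2 p q :
  sortable M1 (rcons s1 p) -> sortable M2 (q :: s2) ->
  uniq (s1 ++ s2) -> s1 ++ s2 =i mground M ->
  (forall B1 B2, B1 \subset [set x in s1] -> B2 \subset [set x in s2] ->
     (B1 :|: B2 \in mbases M) =
     (B1 \in mbases M1) && (q |: B2 \in mbases M2) ||
     (p |: B1 \in mbases M1) && (B2 \in mbases M2)) ->
  sortable M (s1 ++ s2).
Proof.
case=> us1 gs1 h1 [us2 gs2 h2] us gM bM; split=> //.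
move: (us1); rewrite rcons_uniq => /andP[ps1 us1'].
move: (us2) => /= /andP[qs2 us2'].
have dis x : x \in s1 -> x \in s2 -> False.
  by move: us; rewrite cat_uniq => /and3P[_ /hasPn h _] x1 /h; rewrite /= x1.
have split B : B \in mbases M -> exists C1 C2,
    [/\ C1 \in mbases M1, C2 \in mbases M2, (p \in C1) + (q \in C2) = 1,
        {in s1, C1 =i B} & {in s2, C2 =i B}].
  move=> BM; have := bM (B :&: [set z in s1]) (B :&: [set z in s2]).
  rewrite -setIUr (setIidPl (_ : B \subset [set z in s1] :|: [set z in s2])) ?BM;
    last first.
    by apply/subsetP => x /(subsetP (mbases_sub BM)); rewrite -gM mem_cat !inE.
  move=> /(_ (subsetIr _ _) (subsetIr _ _))/esym/orP[] /andP[C1 C2].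
    exists (B :&: [set z in s1]), (q |: (B :&: [set z in s2])); split=> //.
    - by rewrite !inE eqxx (negPf ps1) andbF.
    - by move=> x xs; rewrite !inE xs andbT.
    - move=> x xs; rewrite !inE xs andbT; case: eqP => // e.
      by rewrite e (negPf qs2) in xs.
  exists (p |: (B :&: [set z in s1])), (B :&: [set z in s2]); split=> //.
  - by rewrite !inE eqxx (negPf qs2) andbF.
  - move=> x xs; rewrite !inE xs andbT; case: eqP => // e.
    by rewrite e (negPf ps1) in xs.
  - by move=> x xs; rewrite !inE xs andbT.
have join C1 C2 : C1 \in mbases M1 -> C2 \in mbases M2 ->
    (p \in C1) + (q \in C2) = 1 -> (C1 :\ p) :|: (C2 :\ q) \in mbases M.
  move=> C1M C2M pq; rewrite bM; first last.
  - apply/subsetP => x; rewrite !inE => /andP[xq xC].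
    by have := subsetP (mbases_sub C2M) x xC; rewrite -gs2 inE (negPf xq).
  - apply/subsetP => x; rewrite !inE => /andP[xp xC].
    by have := subsetP (mbases_sub C1M) x xC; rewrite -gs1 mem_rcons inE (negPf xp).
  have rm (C : {set T}) x : x \notin C -> C :\ x = C.
    by move=> xC; apply/setP => y; rewrite !inE; case: eqP => // ->; rewrite (negPf xC).
  case pC: (p \in C1) pq; case qC: (q \in C2) => // _.
    by rewrite (setD1K pC) C1M (rm _ _ (negbT qC)) C2M orbT.
  by rewrite (setD1K qC) C2M (rm _ _ (negbT pC)) C1M.
move=> A B AM BM.
have [A1 [A2 [A1M A2M pqA eA1 eA2]]] := split _ AM.
have [B1 [B2 [B1M B2M pqB eB1 eB2]]] := split _ BM.
have [X1 [Y1 [X1M Y1M e1 il1]]] := h1 _ _ A1M B1M.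
have [X2 [Y2 [X2M Y2M e2 il2]]] := h2 _ _ A2M B2M.
have tot1 : cnt s1 X1 (size s1) + (p \in X1) = cnt s1 Y1 (size s1) + (p \in Y1).
  have := basis_card X1M Y1M; rewrite -!(cnt_size us1);
    try by move=> x; rewrite gs1; apply/subsetP/mbases_sub.
  rewrite size_rcons -cats1 !cnt_cat !(@cnt_oversize s1 _ (size s1).+1) //.
  by rewrite subSnn !cnt_seq1.
have pXY : (p \in X1) <= (p \in Y1).
  move: tot1 (il1 (size s1)); rewrite -cats1 !cnt_cat subnn !cnt0 !addn0; clear; lia.
have qXY : (q \in Y2) <= (q \in X2).
  by have := il2 1; rewrite -cat1s !cnt_cat subnn !cnt0 !addn0 !cnt_seq1 // => /andP[].
have := e1 p; have := e2 q => eq ep.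
have [pqX pqY] : (p \in X1) + (q \in X2) = 1 /\ (p \in Y1) + (q \in Y2) = 1.
  by move: pqA pqB pXY qXY ep eq; clear; lia.
have c1 C1 C2 i : C1 \in mbases M1 -> C2 \in mbases M2 ->
    cnt s1 ((C1 :\ p) :|: (C2 :\ q)) i = cnt s1 C1 i.
  move=> C1M C2M; apply: eq_in_cnt => x xs; rewrite !inE.
  have -> : x != p by apply: contraNneq ps1 => <-.
  case: eqP => /= xq; first by rewrite orbF.
  have [/(subsetP (mbases_sub C2M))|] := boolP (x \in C2); last by rewrite orbF.
  by rewrite -gs2 inE => /orP[/eqP //|/(dis _ xs)].
have c2 C1 C2 i : C1 \in mbases M1 -> C2 \in mbases M2 ->
    cnt s2 ((C1 :\ p) :|: (C2 :\ q)) i = cnt s2 C2 i.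
  move=> C1M C2M; apply: eq_in_cnt => x xs; rewrite !inE.
  have -> : x != q by apply: contraNneq qs2 => <-.
  case: eqP => //= xp.
  have [/(subsetP (mbases_sub C1M))|//] := boolP (x \in C1).
  by rewrite -gs1 mem_rcons inE => /orP[/eqP //|/dis/(_ xs)].
exists (X1 :\ p :|: X2 :\ q), (Y1 :\ p :|: Y2 :\ q); split; try exact: join.
- move=> x; have : x \notin mground M -> (x \in A) + (x \in B) = 0.
    move=> xM; rewrite (contraNF (subsetP (mbases_sub AM) x)) //.
    by rewrite (contraNF (subsetP (mbases_sub BM) x)).
  rewrite -gM mem_cat.
  have out1 C : C \in mbases M1 -> x \notin rcons s1 p -> x \notin C.
    by move=> /mbases_sub/subsetP/(_ x) h; rewrite gs1; apply: contra.
  have out2 C : C \in mbases M2 -> x \notin q :: s2 -> x \notin C.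
    by move=> /mbases_sub/subsetP/(_ x) h; rewrite gs2; apply: contra.
  move: (out1 _ X1M) (out1 _ Y1M) (out2 _ X2M) (out2 _ Y2M).
  rewrite mem_rcons !in_cons !inE.
  have [x1|x1] := boolP (x \in s1).
    have -> : x == p = false by apply: contraNF ps1 => /eqP <-.
    have -> /= : x \in s2 = false by apply/negP => /(dis _ x1).
    rewrite orbF -eA1 // -eB1 // -e1 => _ _ + + _.
    by case: eqP => /= _; [rewrite !orbF | move=> /(_ isT)/negPf -> /(_ isT)/negPf ->;
      rewrite !orbF].
  have [x2|x2] := boolP (x \in s2).
    have -> /= : x == q = false by apply: contraNF qs2 => /eqP <-.
    rewrite orbF -eA2 // -eB2 // -e2 => + + _ _ _.
    by case: eqP => /= _; last by move=> /(_ isT)/negPf -> /(_ isT)/negPf ->.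
  rewrite !orbF /= => + + + + /(_ isT) ->.
  by case: eqP => _ /=; case: eqP => _ //=;
    do ?[move=> /(_ isT)/negPf -> | move=> _].
move=> i; rewrite !cnt_cat !c1 // !c2 //.
have [hi|hi] := leqP i (size s1).
  by have := il1 i; rewrite -cats1 !cnt_cat (eqP hi) !cnt0 !addn0.
rewrite !(@cnt_oversize s1 _ i) ?(ltnW hi) //.
have := il2 (1 + (i - size s1)); rewrite -cat1s !cnt_cat addKn !cnt_seq1 //.
by move: pqX pqY tot1; clear; lia.
Qed.

End Sortable.

(** * Labelled matroids on six points *)

Lemma rank3_triple (B : {set 'I_6}) : #|B| = 3 ->
  exists i j k : 'I_6, [/\ i < j, j < k & B = [set i; j; k]].
Proof.
move=> B3; have sB : size (enum B) = 3 by rewrite -cardE.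
have srt : sorted ltn (map val (enum B)).
  rewrite sorted_map; apply: sorted_filter.
    by move=> x y z; apply: ltn_trans.
  by rewrite -[sorted _ _](@sorted_map _ _ val ltn) -enumT val_enum_ord iota_ltn_sorted.
case eB: (enum B) sB srt => [|i [|j [|k [|]]]] //= _ /and3P[ij jk _].
exists i, j, k; split=> //; apply/setP => x.
by rewrite -mem_enum eB !inE orbA.
Qed.

Definition labelling (U : finType) (N : matroid U) (h : 'I_6 -> U)
    (ls : seq (seq nat)) :=
  [/\ injective h, mground N = [set h i | i in 'I_6],
      forall B, B \in mbases N -> #|B| = 3 &
      forall i j k : 'I_6, i < j -> j < k ->
        ([set h i; h j; h k] \in mbases N) =
        ~~ has (fun l => [&& val i \in l, val j \in l & val k \in l]) ls].

Lemma labelling_basis (U : finType) (N : matroid U) h ls (B : {set 'I_6}) :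
  labelling N h ls -> ([set h i | i in B] \in mbases N) =
    (#|B| == 3) && ~~ has (fun l : seq nat => [forall x in B, val x \in l]) ls.
Proof.
case=> ih _ b3 bl; apply/idP/andP => [BM|[/eqP/rank3_triple[i [j [k [ij jk ->]]]]]].
  have /rank3_triple[i [j [k [ij jk eB]]]] : #|B| = 3.
    by rewrite -(card_imset _ ih) b3.
  split; first by rewrite -(card_imset _ ih) b3.
  move: BM; rewrite eB !imsetU !imset_set1 bl //;
    apply: contra => /hasP[l lls /forall_inP h0]; apply/hasP.
  by exists l => //; rewrite !h0 // !inE eqxx ?orbT.
move=> h0; rewrite !imsetU !imset_set1 bl //;
  apply: contra h0 => /hasP[l lls /and3P[h1 h2 h3]].
apply/hasP; exists l => //; apply/forall_inP => x.
by rewrite !inE => /orP[/orP[]|] /eqP ->.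
Qed.

Lemma labelling_iso (U V : finType) (N : matroid U) (P : matroid V) h g ls :
  labelling N h ls -> labelling P g ls -> matroid_iso N P.
Proof.
move=> lN lP; have [ih gN _ _] := lN; have [ig gP _ _] := lP.
have hN i : h i \in mground N by rewrite gN imset_f.
have gP' i : g i \in mground P by rewrite gP imset_f.
pose h' i : {x in mground N} := exist _ (h i) (hN i).
pose g' i : {x in mground P} := exist _ (g i) (gP' i).
have bh : bijective h'.
  apply: inj_card_bij => [i j /(congr1 val)/ih //|].
  by rewrite card_sig gN card_imset.
have bg : bijective g'.
  apply: inj_card_bij => [i j /(congr1 val)/ig //|].
  by rewrite card_sig gP card_imset.
have [k hk kh] := bh; exists (g' \o k).
  by apply: bij_comp => //; exists h'.
move=> A; have -> : [set val x | x in A] = [set h i | i in k @: A].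
  by rewrite -imset_comp; apply: eq_imset => x; rewrite /= -{1}(kh x).
have -> : [set val ((g' \o k) x) | x in A] = [set g i | i in k @: A].
  by rewrite -imset_comp; apply: eq_imset => x.
by rewrite (labelling_basis _ lN) (labelling_basis _ lP).
Qed.

Lemma line_matroid_labelling ls ok nz : labelling (@line_matroid 6 ls ok nz) id ls.
Proof.
split.
- by move=> x.
- by apply/setP => x; rewrite /= in_setT; apply/esym/imsetP; exists x.
- by move=> B /=; rewrite inE => /andP[/eqP].
move=> i j k ij jk; rewrite /= inE.
have -> : #|[set i; j; k]| = 3.
  rewrite setUC cardsU1 cards2 !inE -!val_eqE /=.
  by rewrite (ltn_eqF ij) !gtn_eqF // (ltn_trans ij).
congr (~~ _); apply: eq_has => l; apply/forall_inP/and3P => [h|[h1 h2 h3] x].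
  by rewrite !h // !inE eqxx ?orbT.
by rewrite !inE => /orP[/orP[]|] /eqP ->.
Qed.

Definition K4_lines := [:: [:: 0; 1; 2]; [:: 2; 3; 4]; [:: 4; 5; 0]; [:: 1; 3; 5]].

Lemma triangle_of_nonforest (F : {set {set 'I_4}}) : #|F| <= 3 -> ~~ forest F ->
  exists x y z, [/\ adj F x y, adj F y z & adj F z x].
Proof.
move=> F3 /forestP nf.
have [/existsP[x /existsP[y /existsP[z /and3P[]]]]|none] :=
  boolP [exists x, exists y, exists z, [&& adj F x y, adj F y z & adj F z x]].
  by move=> *; exists x, y, z.
case: nf => c /andP[cy uc]; rewrite leqNgt; apply/negP => c3.
have c4 : size c <= 4 by rewrite -(card_uniqP uc) -[X in _ <= X](card_ord 4) max_card.
case: c cy uc c3 c4 => [|x [|y [|z [|t [|]]]]] //=.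
  rewrite andbT => /and3P[h1 h2 h3] _ _ _; case/negP: none.
  by apply/existsP; exists x; apply/existsP; exists y; apply/existsP; exists z;
    apply/and3P.
rewrite !inE !negb_or andbT.
case/and4P=> /andP[_ h1] /andP[_ h2] /andP[_ h3] /andP[_ h4].
case/and3P=> /and3P[xy xz xt] /andP[yz yt] zt _ _.
rewrite andbT in zt; have ne (a b u v : 'I_4) : (a != u) && (a != v) -> [set a;
  b] == [set u; v] = false.
  case/andP=> au av; apply/negP => /eqP/set2_eq[[e _]|[e _]];
  by [rewrite e eqxx in au | rewrite e eqxx in av].
have : 4 <= size (enum F).
  apply: (@uniq_leq_size _ [:: [set x; y]; [set y; z]; [set z; t]; [set t; x]]).
    have yx : y != x by rewrite eq_sym.
    have zx : z != x by rewrite eq_sym.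
    by rewrite /= !inE (ne x y y z) ?(ne x y z t) ?(set2C x y) ?(ne y x t x)
      ?(ne y z z t) ?(ne y z t x) ?(ne z t t x) ?xy ?xz ?xt ?yz ?yt ?zt ?yx ?zx.
  by move=> f; rewrite mem_enum !inE => /or4P[] /eqP ->.
by rewrite -cardE leqNgt ltnS F3.
Qed.

(* A point of the presentation [K4_lines] is an edge of K4; its four lines are
   the triangles that miss the vertices 3, 0, 1, 2. *)
Definition K4_ends := [:: (0, 2); (0, 1); (1, 2); (1, 3); (2, 3); (0, 3)].

Definition K4_edge (i : 'I_6) : {set 'I_4} :=
  let p := nth (0, 0) K4_ends i in [set inord p.1; inord p.2].

Lemma K4_edge_eq (x y : 'I_4) i : ([set x; y] == K4_edge i) =
  let p := nth (0, 0) K4_ends i in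
  (val x == p.1) && (val y == p.2) || (val x == p.2) && (val y == p.1).
Proof.
have [l1 l2] : (nth (0, 0) K4_ends i).1 < 4 /\ (nth (0, 0) K4_ends i).2 < 4.
  by case: i => [[|[|[|[|[|[|]]]]]]].
apply/eqP/orP => [/set2_eq[[-> ->]|[-> ->]]|[]/andP[/eqP e1 /eqP e2]].
- by left; rewrite /= !inordK ?eqxx.
- by right; rewrite /= !inordK ?eqxx.
- by rewrite /K4_edge -e1 -e2 !inord_val.
- by rewrite /K4_edge -e1 -e2 !inord_val set2C.
Qed.

Definition K4_adj (t : seq nat) (x y : nat) := (x != y) &&
  has (fun i => let p := nth (0, 0) K4_ends i in
    (x == p.1) && (y == p.2) || (x == p.2) && (y == p.1)) t.

Definition K4_triangle t :=
  has (fun x => has (fun y => has (fun z =>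
    [&& K4_adj t x y, K4_adj t y z & K4_adj t z x]) (iota 0 4)) (iota 0 4)) (iota 0 4).

Lemma K4_triangleE i j k : i < j -> j < k -> k < 6 -> K4_triangle [:: i; j; k] =
  has (fun l => [&& i \in l, j \in l & k \in l]) K4_lines.
Proof.
have : all (fun i => all (fun j => all (fun k => (i < j < k) ==>
    (K4_triangle [:: i; j;
      k] == has (fun l => [&& i \in l, j \in l & k \in l]) K4_lines))
    (iota 0 6)) (iota 0 6)) (iota 0 6) by vm_compute.
move=> h ij jk k6; have j6 := ltn_trans jk k6; have i6 := ltn_trans ij j6.
move/allP/(_ i)/(_ _)/allP/(_ j)/(_ _)/allP/(_ k): h; rewrite !mem_iota /=.
by move=> /(_ i6 j6 k6); rewrite ij jk => /eqP.
Qed.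

Lemma adj_K4_edge (i j k : 'I_6) x y :
  adj [set K4_edge i; K4_edge j; K4_edge k] x y = K4_adj [:: val i; val j; val k] x y.
Proof. by rewrite /adj !inE !K4_edge_eq /K4_adj /= orbF -orbA. Qed.

Lemma K4_edge_inj : injective K4_edge.
Proof.
move=> i j /eqP; rewrite K4_edge_eq /= => h; apply: val_inj => /=.
case: i j h => [[|[|[|[|[|[|//]]]]]] ?] [[|[|[|[|[|[|//]]]]]] ?] //=;
  by rewrite !inordK.
Qed.

Lemma card3_imset (U : finType) (h : 'I_6 -> U) (i j k : 'I_6) : injective h ->
  i < j -> j < k -> #|[set h i; h j; h k]| = 3.
Proof.
move=> ih ij jk; rewrite setUC cardsU1 cards2 !inE !(inj_eq ih) -!val_eqE /=.
by rewrite (ltn_eqF ij) !gtn_eqF // (ltn_trans ij).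
Qed.

Lemma MK4_labelling : labelling MK4 K4_edge K4_lines.
Proof.
have forestE (i j k : 'I_6) : i < j -> j < k ->
    forest [set K4_edge i; K4_edge j; K4_edge k] =
    ~~ has (fun l => [&& val i \in l, val j \in l & val k \in l]) K4_lines.
  move=> ij jk; rewrite -K4_triangleE ?ltn_ord //.
  have c3 := card3_imset K4_edge_inj ij jk.
  apply/idP/idP => [/forestP ac|]; last first.
    apply: contraR => /triangle_of_nonforest; rewrite c3 => -[] // x [y [z]].
    rewrite !adj_K4_edge => -[xy yz zx].
    apply/hasP; exists (val x); first by rewrite mem_iota /= ltn_ord.
    apply/hasP; exists (val y); first by rewrite mem_iota /= ltn_ord.
    apply/hasP; exists (val z); first by rewrite mem_iota /= ltn_ord.
    by rewrite xy yz.
  apply/hasPn => x; rewrite mem_iota => x4; apply/hasPn => y; rewrite mem_iota => y4.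
  apply/hasPn => z; rewrite mem_iota => z4; apply/negP => /and3P[].
  rewrite -[x]/(val (Ordinal x4)) -[y]/(val (Ordinal y4)) -[z]/(val (Ordinal z4)).
  rewrite -!adj_K4_edge => xy yz zx.
  have /ac : ucycle (adj [set K4_edge i; K4_edge j; K4_edge k])
     [:: Ordinal x4; Ordinal y4; Ordinal z4] by
    rewrite /ucycle /= xy yz zx !inE negb_or (andP xy).1 (andP yz).1 eq_sym (andP zx).1.
  by [].
have e2 f : f \in complete_graph 'I_4 -> exists i, f = K4_edge i.
  rewrite inE => /cards2P[x [y [xy ->]]].
  suff /hasP[n] : has (fun i => let p := nth (0, 0) K4_ends i in
      (val x == p.1) && (val y == p.2) || (val x == p.2) && (val y == p.1)) (iota 0 6).
    rewrite mem_iota /= => n6 h; exists (Ordinal n6); apply/eqP.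
    by rewrite K4_edge_eq.
  move: xy; rewrite -val_eqE.
  by case: x y => [[|[|[|[|//]]]] ?] [[|[|[|[|//]]]] ?].
have K4_edgeG n : K4_edge n \in complete_graph 'I_4.
  rewrite inE cards2 -val_eqE /=.
  by case: n => [[|[|[|[|[|[|//]]]]]] ?] /=; rewrite !inordK.
pose o (k : nat) (lt : k < 6) : 'I_6 := Ordinal lt.
pose S := [set K4_edge (o 0 isT); K4_edge (o 1 isT); K4_edge (o 5 isT)].
have SM : S \in mbases MK4.
  apply/cycle_basesP; first exact: complete_graph2.
  split; [|exact: (etrans (forestE _ _ _ _ _))|].
    by apply/subsetP => f; rewrite in_setU in_set1 in_set2 => /orP[/orP[]|] /eqP ->.
  have c0 x : connect (adj S) ord0 x.
    have [->|x0] := eqVneq x ord0; first exact: connect0.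
    apply: connect1; rewrite adj_K4_edge.
    by case: x x0 => [[|[|[|[|//]]]] ?].
  move=> x y _ _; apply: connect_trans (c0 y).
  by rewrite connect_adjC.
have b3 B : B \in mbases MK4 -> #|B| = 3.
  by move=> BM; rewrite (basis_card BM SM) card3_imset //; apply: K4_edge_inj.
split=> //; first exact: K4_edge_inj.
  apply/setP => f; apply/idP/imsetP => [/e2[i ->]|[i _ ->]]; first by exists i.
  exact: K4_edgeG.
move=> i j k ij jk; rewrite -forestE //; apply/idP/idP => [|ac].
  by case/(cycle_basesP (@complete_graph2 _)).
have c3 := card3_imset K4_edge_inj ij jk.
set F := [set _; _; _] in ac c3 *.
have [|B mB FB] := @maxset_exists _ (fun A => (A \subset complete_graph 'I_4) &&
  forest A) F.
  rewrite ac andbT; apply/subsetP => f.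
  by rewrite in_setU in_set1 in_set2 => /orP[/orP[]|] /eqP ->.
have BM : B \in mbases MK4 by rewrite inE.
suff -> : F = B by [].
by apply/eqP; rewrite eqEcard FB c3 b3.
Qed.

Definition has_forbidden_minor (T : finType) (M : matroid T) :=
  [\/ has_minor M MK4, has_minor M W3, has_minor M P6 | has_minor M Q6].

Lemma has_forbidden_minor_trans (T : finType) (M N : matroid T) :
  is_minor M N -> has_forbidden_minor N -> has_forbidden_minor M.
Proof.
move=> MN [] h; [apply: Or41|apply: Or42|apply: Or43|apply: Or44];
exact: has_minor_trans MN h.
Qed.

Section CircuitHyperplane.
Variables (T : finType) (N : matroid T) (C D : {set T}).
Hypothesis gN : mground N = C :|: D.
Hypothesis dCD : [disjoint C & D].
Hypothesis C3 : #|C| = 3.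
Hypothesis D3 : #|D| = 3.
Hypothesis rE : rk N (mground N) = 3.
Hypothesis rC : rk N C = 2.
Hypothesis rCx : forall c, c \in C -> rk N (C :\ c) = 2.
Hypothesis rCD : forall x, x \in D -> rk N (x |: C) = 3.
Hypothesis rD : rk N D = 3.

Let ind x y z := rk N [set x; y; z] == 3.

Lemma card3_with (A : {set T}) x : #|A| = 3 -> x \in A ->
  exists y z, [/\ A = [set x; y; z], x != y, x != z & y != z].
Proof.
move=> A3 xA; have /eqP/cards2P[y [z [yz eA]]] : #|A :\ x| = 2.
  by move: A3; rewrite (cardsD1 x) xA => -[].
exists y, z; split=> //; first by rewrite -(setD1K xA) eA setUA.
  by have := set21 y z; rewrite -eA !inE eq_sym => /andP[].
by have := set22 y z; rewrite -eA !inE eq_sym => /andP[].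
Qed.

Lemma card3_with2 (A : {set T}) x y : #|A| = 3 -> x \in A -> y \in A -> x != y ->
  exists z, [/\ A = [set x; y; z], x != z & y != z].
Proof.
move=> A3 xA yA xy; have [u [v [eA xu xv uv]]] := card3_with A3 xA.
move: yA; rewrite eA !inE eq_sym (negPf xy) /= => /orP[] /eqP ->.
  by exists v.
by exists u; split=> //; [rewrite setUAC | rewrite eq_sym].
Qed.

Lemma rk_le3 A : rk N A <= 3. Proof. by rewrite -rE rk_le_ground. Qed.

Lemma ind_two_of_circuit x y z : x \in C -> y \in C -> x != y -> z \in D -> ind x y z.
Proof.
move=> xC yC xy zD; have [w [eC xw yw]] := card3_with2 C3 xC yC xy.
have wC : w \in C by rewrite eC !inE eqxx orbT.
have exy : C :\ w = [set x; y].
  apply/setP => t; rewrite eC !inE; case: (eqVneq t w) => [->|_] /=.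
    by rewrite ![w == _]eq_sym (negPf xw) (negPf yw).
  by rewrite orbF.
have r2 : rk N [set x; y] = 2 by rewrite -exy rCx.
rewrite /ind setUC; apply/eqP; have [h|->] := rkU1 N [set x; y] z; last by rewrite r2.
have sxy : [set x; y] \subset C by rewrite eC subsetUl.
by have := rk_spanS sxy h; rewrite rCD // rC.
Qed.

Lemma rk_sub_ind x y z : ind x y z -> #|[set x; y; z]| = 3 ->
  forall A : {set T}, A \subset [set x; y; z] -> rk N A = #|A|.
Proof. by move=> /eqP h c A sA; apply: indep_sub sA _; rewrite h c. Qed.

Lemma rk_dep x y z : x \in C -> y \in D -> z \in D -> y != z -> ~~ ind x y z ->
  rk N [set x; y; z] = 2 /\ rk N [set y; z] = 2.
Proof.
move=> xC yD zD yz; rewrite /ind => h.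
have r2 : rk N [set y; z] = 2.
  have <- : #|[set y; z]| = 2 by rewrite cards2 yz.
  by apply: (indep_sub (B := D)); rewrite ?rD ?D3 // subUset !sub1set yD.
split=> //; have : [set y; z] \subset [set x; y; z].
  by apply/subsetP => t; rewrite !inE => /orP[] ->; rewrite ?orbT.
move/(rkS N); have := rk_le3 [set x; y; z]; rewrite r2; move: h; lia.
Qed.

Lemma dep_unique_point x x' y z : x \in C -> x' \in C -> x != x' ->
  y \in D -> z \in D -> y != z -> ~~ ind x y z -> ind x' y z.
Proof.
move=> xC x'C xx' yD zD yz dx; apply/negPn/negP => dx'.
have [r3 r2] := rk_dep xC yD zD yz dx; have [r3' _] := rk_dep x'C yD zD yz dx'.
have /eqP := ind_two_of_circuit xC x'C xx' yD.
have : rk N ([set x; x'] :|: [set y; z]) = 2.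
  rewrite -r2; apply: rk_span => t; rewrite !inE => /orP[] /eqP ->.
    by rewrite setUA r3.
  by rewrite setUA r3'.
have /(rkS N) : [set x; x'; y] \subset [set x; x'] :|: [set y; z].
  by apply/subsetP => t; rewrite !inE => /orP[] ->; rewrite ?orbT.
lia.
Qed.

Lemma dep_unique_pair x y z w : x \in C -> D = [set y; z; w] ->
  y != z -> y != w -> z != w -> ~~ ind x y z -> ind x y w.
Proof.
move=> xC eD yz yw zw dz; apply/negPn/negP => dw.
have yD : y \in D by rewrite eD !inE eqxx.
have zD : z \in D by rewrite eD !inE eqxx orbT.
have wD : w \in D by rewrite eD !inE eqxx !orbT.
have [r3 _] := rk_dep xC yD zD yz dz; have [r3' _] := rk_dep xC yD wD yw dw.
have r2 : rk N [set x; y] = 2.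
  have [u [v [eC xu xv uv]]] := card3_with C3 xC.
  have uC : u \in C by rewrite eC !inE eqxx orbT.
  have h := ind_two_of_circuit xC uC xu yD.
  have xy : x != y by apply: contraTneq yD => <-; rewrite (disjointFr dCD xC).
  have uy : u != y by apply: contraTneq yD => <-; rewrite (disjointFr dCD uC).
  rewrite (rk_sub_ind h); first by rewrite cards2 xy.
    by rewrite setUC cardsU1 cards2 !inE ![y == _]eq_sym (negPf xy) (negPf uy) xu.
  by apply/subsetP => t; rewrite !inE => /orP[] ->; rewrite ?orbT.
have : rk N ([set z; w] :|: [set x; y]) = 2.
  rewrite -r2; apply: rk_span => t; rewrite !inE => /orP[] /eqP ->.
    by rewrite setUC r3.
  by rewrite setUC r3'.
have /(rkS N) : D \subset [set z; w] :|: [set x; y].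
  by apply/subsetP => t; rewrite eD !inE => /orP[/orP[]|] ->; rewrite ?orbT.
rewrite rD; lia.
Qed.

Lemma ind_swap x y z : ind x y z = ind x z y.
Proof. by rewrite /ind setUAC. Qed.

Definition lines_wf (ls : seq (seq nat)) :=
  all (fun i => all (fun j => all (fun k => (i < j < k) ==> ~~ (i < 3 <= j) ==>
    (has (fun l => [&& i \in l, j \in l & k \in l]) ls == (k < 3)))
    (iota 0 6)) (iota 0 6)) (iota 0 6).

Lemma label_circuit_hyperplane a b c d e f ls :
  C = [set a; b; c] -> D = [set d; e; f] -> uniq [:: a; b; c; d; e; f] ->
  lines_wf ls ->
  (forall i j k, i < 3 -> 2 < j -> j < k -> k < 6 ->
     ind (nth a [:: a; b; c] i) (nth a [:: a; b; c; d; e; f] j)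
         (nth a [:: a; b; c; d; e; f] k) =
     ~~ has (fun l => [&& i \in l, j \in l & k \in l]) ls) ->
  labelling N (fun i : 'I_6 => nth a [:: a; b; c; d; e; f] i) ls.
Proof.
move=> eC eD us wf hind; set s := [:: a; b; c; d; e; f] in us hind *.
have ih : injective (fun i : 'I_6 => nth a s i).
  by move=> i j /eqP; rewrite nth_uniq // => /eqP/val_inj.
have hC (i : nat) : i < 3 -> nth a s i \in C.
  by rewrite eC; case: i => [|[|[|]]] // _; rewrite !inE eqxx ?orbT.
have hD (i : nat) : 2 < i -> i < 6 -> nth a s i \in D.
  by rewrite eD; case: i => [|[|[|[|[|[|]]]]]] // _ _; rewrite !inE eqxx ?orbT.
have ground_h : mground N = [set nth a s (val i) | i in 'I_6].
  apply/setP => x; rewrite gN eC eD; apply/idP/imsetP.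
    have -> : x \in [set a; b; c] :|: [set d; e; f] = (x \in s).
      by rewrite !inE -!orbA.
    by move=> xs; have := xs; rewrite -index_mem => lt;
      exists (Ordinal (lt : index x s < 6)); rewrite //= nth_index.
  case=> i _ ->; rewrite -eC -eD inE; case: (ltnP i 3) => hi; first by rewrite hC.
  by rewrite (hD i) ?orbT.
have basisE (i j k : 'I_6) : i < j -> j < k ->
    ([set nth a s i; nth a s j; nth a s k] \in mbases N) =
    ind (nth a s i) (nth a s j) (nth a s k).
  move=> ij jk; rewrite mbasesE rE (card3_imset ih ij jk) eqxx /=.
  rewrite (_ : _ \subset _ = true) //; apply/subsetP => x; rewrite ground_h !inE.
  by case/orP => [/orP[]|] /eqP ->; apply: imset_f.
split=> //.
  by move=> B; rewrite mbasesE rE => /and3P[_ /eqP].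
move=> i j k ij jk; rewrite basisE //.
case: (boolP (i < 3 <= j)) => [/andP[i3 j3]|h].
  rewrite -hind ?ltn_ord //.
  have -> // : nth a [:: a; b; c] (val i) = nth a s i.
  by case: (i) i3 => [[|[|[|]]]].
move/allP/(_ i)/(_ _)/allP/(_ j)/(_ _)/allP/(_ k): wf.
rewrite !mem_iota /= !ltn_ord ij jk h /= => /(_ isT isT isT)/eqP ->.
have ne : nth a s i != nth a s j by rewrite nth_uniq // ltn_eqF.
case: (ltnP k 3) => k3 /=; last first.
  have [i3|i3] := ltnP i 3.
    have j3 : j < 3 by move: h; rewrite i3 -ltnNge.
    by apply: ind_two_of_circuit; rewrite ?hC ?hD.
  have j3 := leq_trans i3 (ltnW ij).
  suff -> : ind (nth a s i) (nth a s j) (nth a s k) = (rk N D == 3) by rewrite rD.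
  rewrite /ind; congr (rk N _ == 3); apply/eqP;
    rewrite eqEcard D3 (card3_imset ih ij jk) andbT.
  by apply/subsetP => x; rewrite !inE => /orP[/orP[]|] /eqP ->; apply: hD.
apply/negbTE; have j3 := ltn_trans jk k3; have i3 := ltn_trans ij j3.
have : [set nth a s i; nth a s j; nth a s k] \subset C.
  by apply/subsetP => x; rewrite !inE => /orP[/orP[]|] /eqP ->; apply: hC.
by rewrite /ind => /(rkS N); rewrite rC; case: eqP => // ->.
Qed.

Ltac ninecases ff := move=> [|[|[|?]]] // [|[|[|[|[|?]]]]] [|[|[|[|[|[|?]]]]]] //= _ _
  _ _;
  rewrite ?ff //.

Lemma two_lines a b c d e f : C = [set a; b; c] -> D = [set d; e; f] ->
  uniq [:: a; b; c; d; e; f] -> ~~ ind c d e -> ~~ ind a e f ->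
  has_forbidden_minor N.
Proof.
move=> eC eD us dc da.
have [aC bC cC] : [/\ a \in C, b \in C & c \in C] by rewrite eC !inE !eqxx !orbT.
have [dD eD' fD] : [/\ d \in D, e \in D & f \in D] by rewrite eD !inE !eqxx !orbT.
have := us; rewrite /= !inE !negb_or !andbT.
case/and5P=> /and5P[ab ac _ _ _] /and4P[bc _ _ _] _ /andP[de df] ef.
have eD2 : D = [set e; f; d] by rewrite eD -setUA setUC.
have eD3 : D = [set e; d; f] by rewrite eD [[set d; e]]setUC.
have eD4 : D = [set f; e; d] by rewrite eD2 [[set e; f]]setUC.
have f1 : ind a d e = true by apply: dep_unique_point dc; rewrite // eq_sym.
have f2 : ind b d e = true by apply: dep_unique_point dc; rewrite // eq_sym.
have f3 : ind c d f = true by apply: dep_unique_pair eD _ _ _ dc.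
have f4 : ind c e f = true.
  by apply: (dep_unique_pair (z := d)) eD3 _ _ _ _; rewrite // 1?eq_sym // ind_swap.
have f5 : ind b e f = true by apply: dep_unique_point da.
have f6 : ind a d f = true.
  rewrite ind_swap; apply: (dep_unique_pair (z := e)) eD4 _ _ _ _;
    rewrite // 1?eq_sym //.
  by rewrite ind_swap.
have f7 := negbTE dc; have f8 := negbTE da.
case f9: (ind b d f).
  apply: Or42; exists N; first exact: minor_refl.
  apply: (labelling_iso (ls := W3_lines)) (line_matroid_labelling _ _).
  apply: (label_circuit_hyperplane eC eD us) => //.
  ninecases (f1,f2,f3,f4,f5,f6,f7,f8,f9).
apply: Or41; exists N; first exact: minor_refl.
apply: (labelling_iso (ls := K4_lines)) MK4_labelling.
apply: (label_circuit_hyperplane eC eD us) => //.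
ninecases (f1,f2,f3,f4,f5,f6,f7,f8,f9).
Qed.

Lemma circuit_hyperplane6 : has_forbidden_minor N.
Proof.
have neCD x y : x \in C -> y \in D -> (x == y) = false.
  by move=> xC yD; apply/eqP => e; rewrite -e (disjointFr dCD xC) in yD.
have uniqCD a b c d e f : C = [set a; b; c] -> D = [set d; e; f] ->
    a != b -> a != c -> b != c -> d != e -> d != f -> e != f ->
    uniq [:: a; b; c; d; e; f].
  move=> eC eD ab ac bc de df ef.
  have [aC bC cC] : [/\ a \in C, b \in C & c \in C] by rewrite eC !inE !eqxx !orbT.
  have [dD eD' fD] : [/\ d \in D, e \in D & f \in D] by rewrite eD !inE !eqxx !orbT.
  rewrite /= !inE (neCD _ _ aC dD) (neCD _ _ aC eD') (neCD _ _ aC fD) (neCD _ _ bC dD)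
    (neCD _ _ bC eD') (neCD _ _ bC fD) (neCD _ _ cC dD) (neCD _ _ cC eD') (neCD _ _ cC
      fD).
  by rewrite (negPf ab) (negPf ac) (negPf bc) (negPf de) (negPf df) (negPf ef).
have [/exists_inP[c cC /exists_inP[d dD /exists_inP[e eD]]]|no] :=
    boolP [exists c in C, exists d in D, exists e in D, (d != e) && ~~ ind c d e].
  case/andP => de dc; have [f [eqD df ef]] := card3_with2 D3 dD eD de.
  have [a [b [eqC ca cb ab]]] := card3_with C3 cC.
  have aC : a \in C by rewrite eqC !inE eqxx ?orbT.
  have bC : b \in C by rewrite eqC !inE eqxx ?orbT.
  have fD : f \in D by rewrite eqD !inE eqxx ?orbT.
  have eqC1 : C = [set a; b; c] by rewrite eqC -setUA setUC.
  have eqC2 : C = [set b; a; c] by rewrite eqC1 [[set a; b]]setUC.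
  have eqD2 : D = [set e; d; f] by rewrite eqD [[set d; e]]setUC.
  have [ac bc] : a != c /\ b != c by rewrite ![_ == c]eq_sym.
  have [ba ed] : b != a /\ e != d by rewrite ![_ == a]eq_sym ![_ == d]eq_sym.
  have dc' : ~~ ind c e d by rewrite ind_swap.
  have u1 := uniqCD _ _ _ _ _ _ eqC1 eqD ab ac bc de df ef.
  have u2 := uniqCD _ _ _ _ _ _ eqC1 eqD2 ab ac bc ed ef df.
  have u3 := uniqCD _ _ _ _ _ _ eqC2 eqD ba bc ac de df ef.
  have u4 := uniqCD _ _ _ _ _ _ eqC2 eqD2 ba bc ac ed ef df.
  case g1: (ind a e f); last by apply: two_lines eqC1 eqD u1 dc _; rewrite g1.
  case g2: (ind a d f); last by apply: two_lines eqC1 eqD2 u2 dc' _; rewrite g2.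
  case g3: (ind b e f); last by apply: two_lines eqC2 eqD u3 dc _; rewrite g3.
  case g4: (ind b d f); last by apply: two_lines eqC2 eqD2 u4 dc' _; rewrite g4.
  have f1 : ind a d e = true by apply: dep_unique_point dc; rewrite // eq_sym.
  have f2 : ind b d e = true by apply: dep_unique_point dc; rewrite // eq_sym.
  have f3 : ind c d f = true by apply: dep_unique_pair eqD _ _ _ dc.
  have f4 : ind c e f = true by apply: dep_unique_pair eqD2 _ _ _ dc'.
  have f5 := negbTE dc.
  apply: Or44; exists N; first exact: minor_refl.
  apply: (labelling_iso (ls := Q6_lines)) (line_matroid_labelling _ _).
  apply: (label_circuit_hyperplane eqC1 eqD u1) => //.
  ninecases (f1,f2,f3,f4,f5,g1,g2,g3,g4).
have [c cC] : exists c, c \in C by apply/card_gt0P; rewrite C3.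
have [d dD] : exists d, d \in D by apply/card_gt0P; rewrite D3.
have [a [b [eqC ca cb ab]]] := card3_with C3 cC.
have [e [f [eqD de df ef]]] := card3_with D3 dD.
have g x y z : x \in C -> y \in D -> z \in D -> y != z -> ind x y z = true.
  move=> xC yD zD yz; apply/negPn/negP => h; case/negP: no.
  apply/exists_inP; exists x => //; apply/exists_inP; exists y => //.
  by apply/exists_inP; exists z => //; rewrite yz.
apply: Or43; exists N; first exact: minor_refl.
apply: (labelling_iso (ls := P6_lines)) (line_matroid_labelling _ _).
apply: (label_circuit_hyperplane eqC eqD) => //; first exact: uniqCD.
by ninecases (eqxx c); apply: g; rewrite ?eqC ?eqD ?inE ?eqxx ?orbT.
Qed.

End CircuitHyperplane.

(** * Circuits and cocircuits that are linked *)

Section Circuits.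
Variable T : finType.
Implicit Types (M : matroid T) (A B C D H S : {set T}) (e x : T).

Definition circuit M C := [/\ C \subset mground M, (rk M C).+1 = #|C| &
  forall c, c \in C -> rk M (C :\ c) = rk M C].

Definition cocircuit M D := [/\ D \subset mground M,
  (rk M (mground M :\: D)).+1 = rk M (mground M) &
  forall x, x \in D -> rk M (x |: (mground M :\: D)) = rk M (mground M)].

(* No 1- or 2-separation of M separates C from D. *)
Definition linked M C D := forall S, C \subset S -> S \subset mground M :\: D ->
  (rk M (mground M)).+2 <= rk M S + rk M (mground M :\: S).

Lemma rk1_of_rkU1 M A e : rk M (e |: A) = (rk M A).+1 -> rk M [set e] = 1.
Proof.
move=> eI; have := rkU1 M set0 e; rewrite setU0 rk0 => -[] // h.
have := rk_spanS (sub0set A) (x := e) (M := M); rewrite setU0 rk0 h eI; lia.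
Qed.

Section Outside.
Variables (M : matroid T) (C D : {set T}) (e : T).
Hypotheses (cC : circuit M C) (cD : cocircuit M D).
Hypotheses (eE : e \in mground M) (eC : e \notin C) (eD : e \notin D).
Let E := mground M.
Let A := (E :\ e) :\: D.

Lemma outsideE : E :\: D = e |: A.
Proof.
apply/setP => z; rewrite !inE; case: (eqVneq z e) => [->|//].
by rewrite eD eE.
Qed.

Lemma eNA : e \notin A. Proof. by rewrite !inE eqxx andbF. Qed.

Lemma circuit_del : circuit (mdel M e) C.
Proof.
have [sC c1 c2] := cC; split.
- by rewrite subsetD1 sC.
- by rewrite rk_mdel.
- by move=> c cC'; rewrite !rk_mdel ?c2 // !inE negb_and eC orbT.
Qed.

Lemma cocircuit_del : rk M A = rk M (E :\: D) -> rk M (E :\ e) = rk M E ->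
  cocircuit (mdel M e) D.
Proof.
move=> rA rE; have [sD d1 d2] := cD; split.
- by rewrite subsetD1 sD.
- by rewrite /= !rk_mdel ?setD11 ?eNA // rE rA.
- move=> x xD; have ex : e \notin x |: A.
    by rewrite in_setU1 negb_or eNA andbT; apply: contraNneq eD => ->.
  rewrite /= !rk_mdel ?setD11 // rE -(d2 x xD) -/E outsideE setUCA; apply/esym;
    apply: (rk_spanS (A := A)) (subsetUr _ _) _.
  by rewrite -outsideE rA.
Qed.

Hypothesis eI : rk M (e |: C) = (rk M C).+1.
Let outside_rk1 := rk1_of_rkU1 eI.

Lemma circuit_contr : circuit (mcontr M e) C.
Proof.
have [sC c1 c2] := cC; split.
- by rewrite subsetD1 sC.
- by have := rk_mcontr M eC; rewrite eI outside_rk1 -c1; clear; lia.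
- move=> c cC'; have eCc : e \notin C :\ c by rewrite !inE negb_and eC orbT.
  have := rk_mcontr M eC; have := rk_mcontr M eCc; rewrite outside_rk1.
  have := @rk_spanS _ M (C :\ c) (e |: (C :\ c)) c (subsetUr _ _).
  by rewrite setUCA setD1K // c2 // eI => /(_ erefl) -> ; clear; lia.
Qed.

Lemma cocircuit_contr : cocircuit (mcontr M e) D.
Proof.
have [sD d1 d2] := cD; split.
- by rewrite subsetD1 sD.
- have := @rk_mcontr _ M e (E :\ e); have := rk_mcontr M eNA.
  rewrite /= -outsideE setD1K // setD11 outside_rk1 -/E -d1 -/E -/A => h1 /(_ isT).
  by move: h1; clear; lia.
- move=> x xD.
  have ex : e \notin x |: A.
    by rewrite in_setU1 negb_or eNA andbT; apply: contraNneq eD => ->.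
  have := @rk_mcontr _ M e (E :\ e); have := rk_mcontr M ex.
  rewrite /= setUCA -outsideE d2 // setD1K // setD11 outside_rk1 => h1 /(_ isT).
  by move: h1; rewrite -/E -/A; clear; lia.
Qed.

End Outside.

Lemma linked_del_spanned M C D e : e \in mground M -> e \notin D ->
  rk M (e |: C) = rk M C -> e \notin C -> linked M C D -> linked (mdel M e) C D.
Proof.
move=> eE eD eS eC lk S sCS sSA /=.
have eS' : e \notin S by apply/negP => /(subsetP sSA); rewrite /= !inE eqxx andbF.
have := lk (e |: S); rewrite !rk_mdel ?(rk_spanS sCS eS) // ?inE ?eqxx ?andbF //.
have rE : rk M (mground M :\ e) = rk M (mground M).
  rewrite -{2}(setD1K eE); apply/esym; apply: (rk_spanS (A := C)) => //.
  by apply: subset_trans sCS (subset_trans sSA _); rewrite /= subsetDl.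
rewrite rE setDDl; apply; first by rewrite (subset_trans sCS) ?subsetUr.
rewrite subUset sub1set inE eD eE (subset_trans sSA) //=.
by rewrite setSD // subsetDl.
Qed.

(* Tutte's linking argument: separations of M \ e and of M / e uncross. *)
Lemma linked_del_or_contr M C D e : e \in mground M -> e \notin C -> e \notin D ->
  D \subset mground M ->
  rk M [set e] = 1 -> rk M (mground M :\ e) = rk M (mground M) ->
  linked M C D -> linked (mdel M e) C D \/ linked (mcontr M e) C D.
Proof.
move=> eE eC eD sD re rE lk; set E := mground M in eE sD rE lk *.
have [/forallP h|/forallPn[S1]] := boolP [forall S : {set T},
    [&& C \subset S & S \subset (E :\ e) :\: D] ==>
    ((rk M E).+2 <= rk M S + rk M ((E :\ e) :\: S))].
  left=> S sCS sSA; move: (h S); rewrite sCS sSA /=.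
  have eS : e \notin S by apply/negP => /(subsetP sSA); rewrite /= !inE eqxx andbF.
  by rewrite !rk_mdel // ?inE ?eqxx ?andbF // rE.
rewrite negb_imply -ltnNge => /andP[/andP[sCS1 sS1] lt1]; right=> S2 sCS2 sS2 /=.
have eS1 : e \notin S1 by apply/negP => /(subsetP sS1); rewrite !inE eqxx andbF.
have eS2 : e \notin S2 by apply/negP => /(subsetP sS2); rewrite /= !inE eqxx andbF.
have S1E z : z \in S1 -> (z \in E) && (z \notin D).
  by move/(subsetP sS1); rewrite !inE => /and3P[-> _ ->].
have S2E z : z \in S2 -> (z \in E) && (z \notin D).
  by move/(subsetP sS2); rewrite !inE => /and3P[-> _ ->].
set T1 := (E :\ e) :\: S1 in lt1; set T2 := (E :\ e) :\: S2.
have eT2 : e \notin T2 by rewrite !inE eqxx andbF.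
have := @rk_mcontr _ M e (E :\ e); have := rk_mcontr M eS2; have := rk_mcontr M eT2.
rewrite setD1K // setD11 re => h1 h2 /(_ isT) h3.
have := rk_submod M S1 (e |: S2); have := rk_submod M T1 (e |: T2).
have -> : S1 :&: (e |: S2) = S1 :&: S2.
  by apply/setP => z; rewrite !inE; case: eqVneq => // ->; rewrite (negPf eS1).
have -> : T1 :&: (e |: T2) = E :\: (S1 :|: (e |: S2)).
  apply/setP => z; rewrite !inE; case: eqVneq => [->|_] /=;
    first by rewrite !andbF orbT.
  by case: (z \in S1); case: (z \in S2); case: (z \in E).
have -> : T1 :|: (e |: T2) = E :\: (S1 :&: S2).
  apply/setP => z; rewrite !inE; case: eqVneq => [->|_] /=.
    by rewrite eE (negPf eS1) orbT.
  by case: (z \in S1); case: (z \in S2); case: (z \in E).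
have := lk (S1 :&: S2); have := lk (S1 :|: (e |: S2)).
have -> : S1 :&: S2 \subset E :\: D.
  by apply/subsetP => z; rewrite !inE => /andP[/S1E/andP[-> ->]].
have -> : S1 :|: (e |: S2) \subset E :\: D.
  apply/subsetP => z; rewrite !inE => /or3P[/S1E/andP[-> ->]|/eqP ->|/S2E/andP[-> ->]]
    //.
  by rewrite eE eD.
rewrite subsetI sCS1 sCS2 (subset_trans sCS1 (subsetUl _ _)) => /(_ isT isT) h4 /(_
  isT isT) h5.
move: lt1 h1 h2 h3 h4 h5; rewrite -/E -/T1 -/T2; clear; lia.
Qed.

Lemma forbidden_of_linked M C D : circuit M C -> cocircuit M D ->
  [disjoint C & D] -> linked M C D -> has_forbidden_minor M.
Proof.
move: {2}#|mground M| (leqnn #|mground M|) => n.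
elim: n M C D => [|n IH] M C D.
  rewrite leqn0 cards_eq0 => /eqP E0 [sC c1 _].
  by move: sC; rewrite E0 subset0 => /eqP C0; rewrite C0 cards0 in c1.
move=> cE cC cD dis lk; set E := mground M in cE.
have [sC c1 c2] := cC; have [sD d1 d2] := cD; rewrite -/E in sC sD d1 d2.
have IHdel e : e \in E -> circuit (mdel M e) C -> cocircuit (mdel M e) D ->
    linked (mdel M e) C D -> has_forbidden_minor M.
  move=> eE h1 h2 h3; apply: (has_forbidden_minor_trans (N := mdel M e)).
    by apply: minor_del eE; apply: minor_refl.
  by apply: IH h1 h2 dis h3; move: cE; rewrite (cardsD1 e) eE.
have IHcontr e : e \in E -> circuit (mcontr M e) C -> cocircuit (mcontr M e) D ->
    linked (mcontr M e) C D -> has_forbidden_minor M.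
  move=> eE h1 h2 h3; apply: (has_forbidden_minor_trans (N := mcontr M e)).
    by apply: minor_contr eE; apply: minor_refl.
  by apply: IH h1 h2 dis h3; move: cE; rewrite (cardsD1 e) eE.
have [sE|/subsetPn[e eE]] := boolP (E \subset C :|: D); last first.
  rewrite inE negb_or => /andP[eC eD].
  have rH := outsideE eE eD; rewrite -/E in rH.
  have sCA : C \subset (E :\ e) :\: D.
    apply/subsetP => z zC; rewrite !inE (disjointFr dis zC) (subsetP sC) // andbT /=.
    by apply: contraNneq eC => <-.
  have [eS|eI] := rkU1 M C e.
    apply: (IHdel e) => //; first exact: circuit_del.
      apply: cocircuit_del => //.
        by rewrite rH (rk_spanS sCA eS).
      rewrite -/E -[in RHS](setD1K eE) (rk_spanS _ eS) //.
      by apply: subset_trans sCA (subsetDl _ _).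
    exact: linked_del_spanned.
  have cC' : circuit (mcontr M e) C by apply: circuit_contr.
  have cD' : cocircuit (mcontr M e) D by apply: (cocircuit_contr (C := C)).
  have re := rk1_of_rkU1 eI.
  have [rA|rA] := rkU1 M ((E :\ e) :\: D) e; last first.
    apply: (IHcontr e) => // S sCS sSA /=.
    have eS : e \notin S by apply/negP => /(subsetP sSA); rewrite /= !inE eqxx andbF.
    have eSI : rk M (e |: S) = (rk M S).+1.
      have [/(rk_spanS sSA) h|//] := rkU1 M S e.
      by have := n_Sn _ (etrans (esym h) rA).
    have eT : e \notin (E :\ e) :\: S by rewrite !inE eqxx andbF.
    have := @rk_mcontr _ M e (E :\ e); have := rk_mcontr M eS; have := rk_mcontr M eT.
    rewrite setD1K // setD11 re eSI => h1 h2 /(_ isT) h3.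
    have := lk S sCS; rewrite -/E rH.
    have -> : E :\: S = e |: ((E :\ e) :\: S) by exact: outsideE.
    rewrite (subset_trans sSA (subsetUr _ _)) => /(_ isT).
    by rewrite h1 -/E; move: h2 h3; clear; lia.
  have rE : rk M (E :\ e) = rk M E.
    by rewrite -[in RHS](setD1K eE) (rk_spanS _ rA) // subsetDl.
  have [h|h] := linked_del_or_contr eE eC eD sD re rE lk; last exact: (IHcontr e).
  apply: (IHdel e) => //; first exact: circuit_del.
  by apply: cocircuit_del => //; rewrite -/E rH rA.
have eE : E = C :|: D by apply/eqP; rewrite eqEsubset sE subUset sC sD.
have EC : E :\: D = C.
  apply/setP => z; rewrite eE !inE; have [zC|zC] := boolP (z \in C).
    by rewrite (disjointFr dis zC).
  by case: (z \in D).
have ED : E :\: C = D.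
  apply/setP => z; rewrite eE !inE; have [zC|zC] := boolP (z \in C).
    by rewrite (disjointFr dis zC).
  by case: (z \in D).
rewrite EC in d1 d2.
have rD : 3 <= rk M D.
  by have := lk C (subxx _); rewrite -/E EC ED -d1 subxx => /(_ isT); lia.
have [C3|C4] := leqP #|C| 3.
  have rD3 : rk M D = 3 by have := rk_le_ground M D; rewrite -/E; lia.
  have rE3 : rk M E = 3 by have := rk_le_ground M D; rewrite -/E; lia.
  have cC3 : #|C| = 3 by rewrite -c1 d1.
  have [D3|D4] := leqP #|D| 3.
    have cD3 : #|D| = 3 by have := rk_card M D; lia.
    have rC2 : rk M C = 2 by lia.
    apply: (@circuit_hyperplane6 _ M C D) => //.
      by move=> c /c2 ->.
    by move=> x /d2 ->.
  have [B [sB iB cB]] := basis_in sD.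
  have /subsetPn[d dD dB] : ~~ (D \subset B).
    by apply/negP => /subset_leq_card; rewrite cB rD3 leqNgt D4.
  have dE := subsetP sD _ dD.
  have dC : d \notin C by rewrite (disjointFl dis dD).
  have rDd : rk M (D :\ d) = 3.
    apply/eqP; rewrite eqn_leq -{1}rD3 rkS ?subsetDl //= -rD3 -cB -iB rkS //.
    by rewrite subsetD1 sB.
  have rEd : rk M (E :\ d) = rk M E.
    apply/eqP; rewrite eqn_leq rkS ?subsetDl //= rE3 -rDd rkS //.
    exact: setSD.
  have eEd : (E :\ d) :\: (D :\ d) = C.
    rewrite -EC; apply/setP => z; rewrite !inE.
    by case: (eqVneq z d) => [->|] //=; rewrite dD.
  have eDd : (E :\ d) :\: C = D :\ d.
    by rewrite -ED; apply/setP => z; rewrite !inE andbCA.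
  apply: (has_forbidden_minor_trans (N := mdel M d)).
    by apply: minor_del dE; apply: minor_refl.
  apply: (IH _ C (D :\ d)).
  - by move: cE; rewrite (cardsD1 d) dE.
  - exact: circuit_del.
  - split=> /=; first exact: setSD.
      by rewrite -/E eEd !rk_mdel ?setD11 // rEd d1.
    move=> x /setD1P[xd xD]; rewrite -/E eEd !rk_mdel ?setD11 ?rEd ?d2 //.
    by rewrite in_setU1 negb_or eq_sym xd.
  - exact: disjointWr (subsetDl _ _) dis.
  move=> S sCS; rewrite /= -/E eEd => sSC.
  have -> : S = C by apply/eqP; rewrite eqEsubset sSC.
  by rewrite eDd !rk_mdel ?setD11 // rEd rDd; lia.
have [c cCC rcD] : exists2 c, c \in C & 4 <= rk M (c |: D).
  have [rD4|rD3] := leqP 4 (rk M D).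
    have [c cCC] : exists c, c \in C by apply/card_gt0P; lia.
    by exists c => //; apply: leq_trans rD4 (rkU1_ge _ _ _).
  have [|c] := @rk_augment _ M D E; first by lia.
  rewrite eE inE => /orP[cCC h|cD' h]; first by exists c => //; lia.
  by move: h; rewrite (setUidPr _) ?sub1set //; lia.
have cE' := subsetP sC _ cCC.
have cND : c \notin D by rewrite (disjointFr dis cCC).
have rc : rk M [set c] = 1.
  have [c' c'C] : exists c', c' \in C :\ c.
    by apply/card_gt0P; move: C4; rewrite (cardsD1 c) cCC; lia.
  move: c'C; rewrite !inE => /andP[c'c c'C].
  rewrite -(cards1 c); apply: (indep_sub (B := C :\ c')).
    by rewrite sub1set !inE eq_sym c'c.
  by rewrite c2 //; move: c1; rewrite (cardsD1 c') c'C; lia.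
have eEc : (E :\ c) :\: D = C :\ c.
  by rewrite -EC; apply/setP => z; rewrite !inE andbCA.
have eDc : (E :\ c) :\: (C :\ c) = D.
  rewrite -ED; apply/setP => z; rewrite !inE.
  by case: (eqVneq z c) => [->|] //=; rewrite cCC.
have con A := @rk_mcontr _ M c A; rewrite rc in con.
have rEc : rk M E = rk (mcontr M c) (E :\ c) + 1 by rewrite -con ?setD11 // setD1K.
have rCc : rk M C = rk (mcontr M c) (C :\ c) + 1 by rewrite -con ?setD11 // setD1K.
apply: (has_forbidden_minor_trans (N := mcontr M c)).
  by apply: minor_contr cE'; apply: minor_refl.
apply: (IH _ (C :\ c) D).
- by move: cE; rewrite (cardsD1 c) cE'.
- split=> /=; first exact: setSD.
    by move: c1; rewrite rCc (cardsD1 c) cCC; clear; lia.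
  move=> x /setD1P[xc xC]; have cx : c \notin (C :\ c) :\ x by rewrite !inE eqxx andbF.
  have := con _ cx; have -> : c |: (C :\ c) :\ x = C :\ x.
    apply/setP => z; rewrite !inE; case: (eqVneq z c) => [->|] //=.
    by rewrite eq_sym xc cCC.
  by rewrite c2 //; move: rCc; clear; lia.
- split=> /=.
  + by rewrite subsetD1 sD.
  + by rewrite -/E eEc; move: d1 rEc rCc; clear; lia.
  + move=> x xD; rewrite -/E eEc; have cx : c \notin x |: (C :\ c).
      by rewrite !inE eqxx orbF; apply: contraNneq cND => ->.
    have := con _ cx; rewrite setUCA setD1K // d2 // rEc; clear; lia.
- exact: disjointWl (subsetDl _ _) dis.
move=> S sCS; rewrite /= -/E eEc => sSC.
have -> : S = C :\ c by apply/eqP; rewrite eqEsubset sSC.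
rewrite eDc; have := con _ cND; move: rcD rEc rCc d1; clear; lia.
Qed.

End Circuits.

(** * Decomposition along separations *)

Section Structure.
Variable T : finType.
Implicit Types (M N : matroid T) (A B C D E S X : {set T}).

Lemma rkU_span M A B X : A \subset B -> rk M A = rk M B -> rk M (X :|: A) = rk M (X
  :|: B).
Proof.
move=> sAB e; have := rk_submod M (X :|: A) B; rewrite -setUA (setUidPr sAB).
have : rk M A <= rk M ((X :|: A) :&: B) by rewrite rkS // subsetI subsetUr.
by have := rkS M (setUS X sAB); rewrite e; lia.
Qed.

Lemma basis_minor M N X B :
  (forall A : {set T}, A \subset mground N -> rk M (X :|: A) = rk N A + rk M X) ->
  B \subset mground N ->
  (B \in mbases N) = (#|B| + rk M X == rk M (X :|: mground N)) &&
                     (rk M (X :|: B) == rk M (X :|: mground N)).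
Proof. by move=> rN sB; rewrite mbasesE sB !rN // !eqn_add2r. Qed.

Lemma card_setU_disjoint E1 E2 B1 B2 : [disjoint E1 & E2] -> B1 \subset E1 ->
  B2 \subset E2 -> #|B1 :|: B2| = #|B1| + #|B2|.
Proof.
move=> dis s1 s2; apply/eqP; rewrite (leq_card_setU B1 B2).2.
exact: disjointWl s1 (disjointWr s2 dis).
Qed.

Lemma direct_sum_bases M E1 E2 B1 B2 : mground M = E1 :|: E2 ->
  [disjoint E1 & E2] -> rk M E1 + rk M E2 <= rk M (mground M) ->
  B1 \subset E1 -> B2 \subset E2 ->
  (B1 :|: B2 \in mbases M) = (#|B1| == rk M E1) && (rk M B1 == rk M E1) &&
    ((#|B2| == rk M E2) && (rk M B2 == rk M E2)).
Proof.
move=> gM dis le s1 s2.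
have cB := card_setU_disjoint dis s1 s2.
have rE : rk M (mground M) = rk M E1 + rk M E2.
  by apply/eqP; rewrite eqn_leq le gM; have := rk_submod M E1 E2; lia.
rewrite mbasesE gM setUSS //= -gM cB rE; apply/idP/idP.
  case/andP => /eqP c /eqP r.
  have i1 : rk M B1 = #|B1|.
    by apply: (indep_sub (subsetUl B1 B2)); rewrite r cB c.
  have i2 : rk M B2 = #|B2|.
    by apply: (indep_sub (subsetUr B1 B2)); rewrite r cB c.
  have := rkS M s1; have := rkS M s2; rewrite i1 i2; lia.
case/andP=> /andP[/eqP -> /eqP r1] /andP[/eqP -> /eqP r2]; rewrite eqxx /=.
by rewrite (rkU_span _ s2 r2) setUC (rkU_span _ s1 r1) setUC -gM rE.
Qed.

Lemma two_separation_side M E1 E2 : mground M = E1 :|: E2 ->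
  [disjoint E1 & E2] -> rk M E1 + rk M E2 = (rk M (mground M)).+1 ->
  exists D p, [/\ p |: D \subset E2, p \notin D, #|D|.+1 = rk M E2,
    rk M (p |: D) = rk M E2 & rk M (E1 :|: D) = rk M (mground M)].
Proof.
move=> gM dis rE.
have s1 : E1 \subset mground M by rewrite gM subsetUl.
have [I [sI iI cI]] := basis_in s1.
have [C [sIC sC iC cC]] := indep_extend (subset_trans sI s1) iI.
pose D := C :&: E2.
have iD : rk M D = #|D| := indep_sub (subsetIl C E2) iC.
have cCE : #|C| = #|C :&: E1| + #|D|.
  rewrite -(card_setU_disjoint dis (subsetIr _ _) (subsetIr _ _)) -setIUr -gM.
  by rewrite (setIidPl sC).
have cD : #|D|.+1 = rk M E2.
  have h1 : #|I| <= #|C :&: E1| by rewrite subset_leq_card // subsetI sIC.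
  have h2 : #|C :&: E1| <= rk M E1.
    by rewrite -(indep_sub (subsetIl C E1) iC) rkS // subsetIr.
  move: cCE h1 h2 rE; rewrite cC cI; clear; lia.
have [F [sDF sF iF cF]] := indep_extend (subsetIr C E2) iD.
have /set0Pn[p pFD] : F :\: D != set0.
  by rewrite setD_eq0; apply/negP => /subset_leq_card; rewrite cF -cD ltnn.
move: pFD; rewrite inE => /andP[pD pF].
have eF : p |: D = F.
  apply/eqP; rewrite eqEcard subUset sub1set pF sDF cF -cD cardsU1 pD /=.
  by rewrite add1n leqnn.
exists D, p; split; rewrite ?eF ?iF //.
apply/eqP; rewrite eqn_leq rk_le_ground -cC -iC rkS //.
apply/subsetP => x xC; have := subsetP sC x xC; rewrite gM !inE xC.
by case/orP => ->; rewrite ?orbT.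
Qed.

Lemma two_sum_half M E1 E2 B1 B2 D1 D2 q : mground M = E1 :|: E2 ->
  [disjoint E1 & E2] -> rk M E1 + rk M E2 = (rk M (mground M)).+1 ->
  #|D2|.+1 = rk M E2 -> rk M (E1 :|: D2) = rk M (mground M) ->
  q |: D1 \subset E1 -> rk M (q |: D1) = rk M E1 ->
  B1 \subset E1 -> B2 \subset E2 ->
  #|B1| = rk M E1 -> #|B2|.+1 = rk M E2 ->
  (rk M (B1 :|: B2) == rk M (mground M)) =
  (rk M (D2 :|: B1) == rk M (mground M)) &&
  (rk M (D1 :|: (q |: B2)) == rk M (mground M)).
Proof.
move=> gM dis rE cD2 rD2 sqD rqD s1 s2 c1 c2.
have -> : D1 :|: (q |: B2) = B2 :|: (q |: D1) by rewrite setUA setUC [D1 :|: _]setUC.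
rewrite (rkU_span _ sqD rqD); apply/idP/andP => [/eqP r|[/eqP r /eqP r2]].
  have r1 : rk M B1 = rk M E1.
    rewrite (indep_sub (subsetUl B1 B2)) ?c1 // r (card_setU_disjoint dis s1 s2).
    by move: rE; rewrite c1 -c2; clear; lia.
  by rewrite (rkU_span _ s1 r1) setUC rD2 -(rkU_span _ s1 r1) setUC r.
have r1 : rk M B1 = rk M E1.
  have := rkS M s1; have := rk_submod M D2 B1; have := rk_card M D2; rewrite r.
  by move: rE cD2; clear; lia.
by rewrite setUC (rkU_span _ s1 r1) r2.
Qed.

Lemma two_sum_bases M E1 E2 B1 B2 D1 D2 p q : mground M = E1 :|: E2 ->
  [disjoint E1 & E2] -> rk M E1 + rk M E2 = (rk M (mground M)).+1 ->
  p |: D2 \subset E2 -> #|D2|.+1 = rk M E2 -> rk M (p |: D2) = rk M E2 ->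
  rk M (E1 :|: D2) = rk M (mground M) ->
  q |: D1 \subset E1 -> #|D1|.+1 = rk M E1 -> rk M (q |: D1) = rk M E1 ->
  rk M (E2 :|: D1) = rk M (mground M) ->
  B1 \subset E1 -> B2 \subset E2 ->
  (B1 :|: B2 \in mbases M) =
  ((#|B1| == rk M E1) && (rk M (D2 :|: B1) == rk M (mground M))) &&
  ((#|B2|.+1 == rk M E2) && (rk M (D1 :|: (q |: B2)) == rk M (mground M))) ||
  ((#|B1|.+1 == rk M E1) && (rk M (D2 :|: (p |: B1)) == rk M (mground M))) &&
  ((#|B2| == rk M E2) && (rk M (D1 :|: B2) == rk M (mground M))).
Proof.
move=> gM dis rE spD cD2 rpD rD2 sqD cD1 rqD rD1 s1 s2.
have gM' : mground M = E2 :|: E1 by rewrite setUC.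
have dis' : [disjoint E2 & E1] by rewrite disjoint_sym.
have rE' : rk M E2 + rk M E1 = (rk M (mground M)).+1 by rewrite addnC.
have h1 := two_sum_half gM dis rE cD2 rD2 sqD rqD s1 s2.
have h2 := two_sum_half gM' dis' rE' cD1 rD1 spD rpD s2 s1.
have sB : B1 :|: B2 \subset mground M by rewrite gM setUSS.
rewrite mbasesE sB /= (card_setU_disjoint dis s1 s2); apply/idP/orP.
  case/andP => /eqP c r.
  have r' := eqP r.
  have i1 : rk M B1 = #|B1|.
    by apply: (indep_sub (subsetUl B1 B2)); rewrite (card_setU_disjoint dis s1 s2) c r'.
  have i2 : rk M B2 = #|B2|.
    by apply: (indep_sub (subsetUr B1 B2)); rewrite (card_setU_disjoint dis s1 s2) c r'.
  have [[e1 e2]|[e1 e2]] : (#|B1| = rk M E1 /\ #|B2|.+1 = rk M E2) \/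
       (#|B2| = rk M E2 /\ #|B1|.+1 = rk M E1).
    have := rkS M s1; have := rkS M s2; rewrite i1 i2.
    by move: rE c; clear; lia.
    by left; move: r; rewrite h1 // => /andP[-> ->]; rewrite e1 e2 !eqxx.
  by right; move: r; rewrite setUC h2 // => /andP[-> ->]; rewrite e1 e2 !eqxx.
case=> /andP[/andP[/eqP e1 r1] /andP[/eqP e2 r2]].
  by rewrite h1 // r1 r2 !andbT; move: rE; rewrite -e1 -e2; clear; lia.
rewrite setUC h2 // r1 r2 !andbT; move: rE; rewrite -e1 -e2; clear; lia.
Qed.

Lemma sortable_last M s p : sortable M s -> p \in mground M ->
  exists s', sortable M (rcons s' p).
Proof.
move=> sM pM; have [us gs _] := sM; move: pM; rewrite -gs => ps.
case/splitPr: ps sM => u v; rewrite -cat_rcons => /sortable_rot h.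
by exists (v ++ u); rewrite rcons_cat.
Qed.

Lemma sortable_first M s p : sortable M s -> p \in mground M ->
  exists s', sortable M (p :: s').
Proof.
move=> sM pM; have [us gs _] := sM; move: pM; rewrite -gs => ps.
by case/splitPr: ps sM => u v /sortable_rot h; exists (v ++ u).
Qed.

Lemma forbidden_minor_of_3connected M A :
  A \subset mground M -> #|A| = rk M (mground M) -> A \notin mbases M ->
  (forall S, S \subset mground M -> S != set0 -> S != mground M ->
     rk M (mground M) < rk M S + rk M (mground M :\: S)) ->
  (forall S, S \subset mground M -> 1 < #|S| -> 1 < #|mground M :\: S| ->
     (rk M (mground M)).+1 < rk M S + rk M (mground M :\: S)) ->
  has_forbidden_minor M.
Proof.
set E := mground M => sA cA; rewrite mbasesE sA cA eqxx /= => rA sep1 sep2.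
have {}rA : rk M A < rk M E by rewrite ltn_neqAle rA rk_le_ground.
have [C /minsetP[dC minC] sCA] := @minset_exists _ (fun X => rk M X < #|X|) A
  (etrans (congr1 _ cA) rA : rk M A < #|A|).
have Cc c : c \in C -> (rk M C).+1 = #|C| /\ rk M (C :\ c) = rk M C.
  move=> cC; have ind : rk M (C :\ c) = #|C :\ c|.
    apply/eqP; rewrite eqn_leq rk_card leqNgt; apply/negP => h.
    by have := minC _ h (subsetDl _ _) => e; move: cC; rewrite -e setD11.
  have := rkS M (subsetDl C [set c]); move: dC; rewrite ind (cardsD1 c C) cC; clear;
    lia.
have [c0 c0C] : exists c, c \in C.
  by apply/card_gt0P; move: dC; clear; lia.
have cC : circuit M C.
  split; first exact: subset_trans sCA sA.
    by case: (Cc _ c0C).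
  by move=> c /Cc[].
have PA : (A \subset E) && (rk M A < rk M E) by rewrite sA.
have [H /maxsetP[/andP[sH rH] maxH] sAH] :=
  @maxset_exists _ (fun X : {set T} => (X \subset E) && (rk M X < rk M E)) A PA.
pose D := E :\: H.
have ED : E :\: D = H by rewrite setDDr setDv set0U (setIidPr sH).
have rD x : x \in D -> (rk M H).+1 = rk M E /\ rk M (x |: H) = rk M E.
  rewrite inE => /andP[xH xE].
  have : ~~ (rk M (x |: H) < rk M E).
    apply: contra xH => h; rewrite -(maxH (x |: H)) ?setU11 ?subsetUr //.
    by rewrite subUset sub1set xE sH.
  have := rk_le_ground M (x |: H); have := rkU1_le M H x; rewrite -/E; move: rH;
    clear; lia.
have [d dD] : exists d, d \in D.
  by apply/set0Pn; rewrite setD_eq0; apply/negP => /(rkS M); rewrite leqNgt rH.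
have cD : cocircuit M D.
  split; first exact: subsetDl.
    by rewrite -/E ED; case: (rD _ dD).
  by move=> x; rewrite -/E ED => /rD[].
have dis : [disjoint C & D].
  apply/pred0P => x /=; rewrite inE; apply/negbTE/negP => /andP[xC /andP[/negP[]]].
  by rewrite (subsetP sAH) // (subsetP sCA).
apply: (forbidden_of_linked cC cD dis) => S sCS; rewrite -/E ED => sSH.
have sS := subset_trans sSH sH.
have dS : d \in E :\: S.
  by move: dD; rewrite !inE => /andP[dH ->]; rewrite (contra (subsetP sSH d)).
have h1 : rk M E < rk M S + rk M (E :\: S).
  apply: sep1 => //; first by apply/set0Pn; exists c0; apply: (subsetP sCS).
  by apply: contraTneq dS => ->; rewrite setDv inE.
have [S2|S1] := ltnP 1 #|S|; last first.
  have eS : S = C.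
    apply/eqP; rewrite eq_sym eqEcard sCS; apply: leq_trans S1 _.
    by apply/card_gt0P; exists c0.
  have r0 : rk M S = 0 by have [h _] := Cc _ c0C; move: S1; rewrite eS -h; clear; lia.
  by move: h1; rewrite r0 add0n ltnNge rk_le_ground.
have [T2|T1] := ltnP 1 #|E :\: S|; first exact: sep2.
have := rk_card M (E :\: S); have := rkS M sSH; have [h _] := rD _ dD.
by move: h1 h T1; clear; lia.
Qed.

Theorem sortable_of_no_forbidden_minor M : ~ has_forbidden_minor M ->
  exists s, sortable M s.
Proof.
move: {2}#|mground M|.+1 (ltnSn #|mground M|) => n.
elim: n M => // n IH M; rewrite ltnS => cM noM; set E := mground M in cM.
have IHminor N : is_minor M N -> #|mground N| < #|E| -> exists s, sortable N s.
  move=> MN cN; apply: IH; first exact: leq_trans cN cM.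
  by move=> /(has_forbidden_minor_trans MN).
have [/forallP unif|/forallPn[A]] := boolP [forall A : {set T},
    (A \subset E) && (#|A| == rk M E) ==> (A \in mbases M)].
  apply: sortable_uniform => A sA cA; have := unif A.
  by rewrite sA cA eqxx.
rewrite negb_imply => /andP[/andP[sA /eqP cA] nA].
have gM S : S \subset E -> E = S :|: (E :\: S).
  by move=> sS; rewrite setUC -{2}(setIidPr sS) setDE -setIUr setUC setUCr setIT.
have disS S : [disjoint S & E :\: S].
  by apply/pred0P => x /=; rewrite inE; case: (x \in S).
have cS S : S \subset E -> #|E| = #|S| + #|E :\: S|.
  by move=> sS; rewrite -(cardsID S E) (setIidPr sS).
have [/exists_inP[S sS /and3P[S0 SE le]]|no1] := boolP [exists (S : {set T} | S
  \subset E),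
    [&& S != set0, S != E & rk M S + rk M (E :\: S) <= rk M E]].
  have [N1 [MN1 g1 r1]] := minor_deletion sS.
  have [N2 [MN2 g2 r2]] := minor_deletion (subsetDl E S).
  have := cS _ sS; have : 0 < #|E :\: S|.
    by rewrite card_gt0 setD_eq0; apply: contra SE => h; rewrite eqEsubset sS.
  have : 0 < #|S| by rewrite card_gt0.
  move=> p1 p2 pE.
  have [|s1 sN1] := IHminor N1 MN1; first by rewrite g1 pE -[X in X < _]addn0 ltn_add2l.
  have [|s2 sN2] := IHminor N2 MN2; first by rewrite g2 pE -[X in X < _]add0n ltn_add2r.
  exists (s1 ++ s2); apply: (sortable_direct_sum sN1 sN2); rewrite g1 g2 //.
    exact: gM.
  move=> B1 B2 sB1 sB2; rewrite (direct_sum_bases (gM _ sS) (disS S) le sB1 sB2).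
  by rewrite !mbasesE g1 g2 sB1 sB2 !r1 // !r2.
have [/exists_inP[S sS /and3P[S2 T2 le]]|no2] := boolP [exists (S : {set T} | S
  \subset E),
    [&& 1 < #|S|, 1 < #|E :\: S| & rk M S + rk M (E :\: S) <= (rk M E).+1]]; last first.
  case: noM; apply: forbidden_minor_of_3connected sA cA nA _ _ => S sS.
    move=> S0 SE; rewrite ltnNge; apply: contra no1 => le; apply/exists_inP.
    by exists S => //; rewrite S0 SE.
  move=> S2 T2; rewrite ltnNge; apply: contra no2 => le; apply/exists_inP.
  by exists S => //; rewrite S2 T2.
have rE : rk M S + rk M (E :\: S) = (rk M E).+1.
  apply/eqP; rewrite eqn_leq le ltnNge; apply: contra no1 => h; apply/exists_inP.
  exists S; rewrite // h andbT -card_gt0 ltnW //=.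
  by apply: contraTneq T2 => ->; rewrite setDv cards0.
have gM1 := gM _ sS; have dis := disS S; have cE := cS _ sS.
set E2 := E :\: S in T2 rE gM1 dis cE {le}.
have [D2 [p [spD pD cD2 rpD rD2]]] := two_separation_side gM1 dis rE.
have gM2 : mground M = E2 :|: S by rewrite setUC.
have dis' : [disjoint E2 & S] by rewrite disjoint_sym.
have rE' : rk M E2 + rk M S = (rk M E).+1 by rewrite addnC.
have [D1 [q [sqD qD cD1 rqD rD1]]] := two_separation_side gM2 dis' rE'.
have sE2 : E2 \subset E by apply: subsetDl.
have pE2 : p \in E2 by rewrite (subsetP spD) ?setU11.
have qS : q \in S by rewrite (subsetP sqD) ?setU11.
have sD2 : D2 \subset E2 by apply: subset_trans (subsetUr _ _) spD.
have sD1 : D1 \subset S by apply: subset_trans (subsetUr _ _) sqD.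
have [||N1 [MN1 g1 r1]] := @minor_exists _ M D2 (p |: S).
- exact: subset_trans sD2 sE2.
- apply/subsetP => x; rewrite !inE => /orP[/eqP ->|xS].
    by rewrite pD (subsetP sE2).
  rewrite (subsetP sS) // andbT; apply/negP => /(subsetP sD2).
  by rewrite (disjointFr dis xS).
have [||N2 [MN2 g2 r2]] := @minor_exists _ M D1 (q |: E2).
- exact: subset_trans sD1 sS.
- apply/subsetP => x;
  rewrite [x \in _ |: _]in_setU1 [x \in _ :\: _]in_setD => /orP[/eqP ->|xS].
    by rewrite qD (subsetP sS).
  rewrite (subsetP sE2) // andbT; apply/negP => /(subsetP sD1).
  by rewrite (disjointFl dis xS).
have pS : p \notin S by rewrite (disjointFl dis pE2).
have qE2 : q \notin E2 by rewrite (disjointFr dis qS).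
have [|t1 sN1] := IHminor N1 MN1.
  by rewrite g1 cardsU1 pS cE addnC ltn_add2l.
have [|t2 sN2] := IHminor N2 MN2.
  by rewrite g2 cardsU1 qE2 cE ltn_add2r.
have [|s1 {}sN1] := sortable_last (p := p) sN1; first by rewrite g1 setU11.
have [|s2 {}sN2] := sortable_first (p := q) sN2; first by rewrite g2 setU11.
have [us1 gs1 _] := sN1; have [us2 gs2 _] := sN2.
have eS1 : [set x in s1] = S.
  apply/setP => x; have := gs1 x; rewrite g1 mem_rcons !inE.
  case: eqP => //= -> _; rewrite (negPf pS); apply/negbTE.
  by move: us1; rewrite rcons_uniq => /andP[].
have eS2 : [set x in s2] = E2.
  apply/setP => x; have := gs2 x; rewrite g2 in_setU1 !in_cons inE.
  case: eqP => //= -> _; rewrite (negPf qE2); apply/negbTE.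
  by case/andP: us2.
exists (s1 ++ s2); apply: (sortable_2sum sN1 sN2).
- move: us1 us2; rewrite rcons_uniq cat_uniq /= => /andP[_ ->] /andP[_ ->].
  rewrite andbT; apply/hasPn => x x2; apply/negP => /= x1.
  have : x \in S by rewrite -eS1 inE.
  by move/(disjointFr dis); rewrite -eS2 inE x2.
- by move=> x; rewrite -/E gM1 -eS2 mem_cat -{1}eS1 !inE.
move=> B1 B2; rewrite eS1 eS2 => sB1 sB2.
rewrite (two_sum_bases gM1 dis rE spD cD2 rpD rD2 sqD cD1 rqD rD1 sB1 sB2).
have rD2' : rk M D2 = #|D2|.
  apply: indep_sub (subsetUr [set p] D2) _.
  by rewrite rpD cardsU1 pD add1n cD2.
have rD1' : rk M D1 = #|D1|.
  apply: indep_sub (subsetUr [set q] D1) _.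
  by rewrite rqD cardsU1 qD add1n cD1.
have G1 : rk M (D2 :|: (p |: S)) = rk M E.
  apply/eqP; rewrite eqn_leq rk_le_ground -rD2 rkS //.
  by apply/subsetP => x; rewrite !inE => /orP[] ->; rewrite ?orbT.
have G2 : rk M (D1 :|: (q |: E2)) = rk M E.
  apply/eqP; rewrite eqn_leq rk_le_ground -rD1 rkS //.
  by apply/subsetP => x; rewrite !in_setU => /orP[] ->; rewrite ?orbT.
have b1 B : B \subset p |: S ->
    (B \in mbases N1) = (#|B| == rk M S) && (rk M (D2 :|: B) == rk M E).
  rewrite -g1 => sB; rewrite (@basis_minor M N1 D2) // ?g1 //.
  rewrite G1 rD2'; congr (_ && _).
  by move: rE cD2; clear; lia.
have b2 B : B \subset q |: E2 ->
    (B \in mbases N2) = (#|B| == rk M E2) && (rk M (D1 :|: B) == rk M E).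
  rewrite -g2 => sB; rewrite (@basis_minor M N2 D1) // ?g2 //.
  rewrite G2 rD1'; congr (_ && _).
  by move: rE cD1; clear; lia.
rewrite !b1 ?setUS // ?(subset_trans sB1) ?subsetUr //.
rewrite !b2 ?setUS // ?(subset_trans sB2) ?subsetUr //.
rewrite !cardsU1 (contra (subsetP sB1 p) pS) (contra (subsetP sB2 q) qE2) !add1n.
by [].
Qed.

End Structure.

(** * Weights and sorted monomials *)

Section Weights.
Variables (T : finType) (M : matroid T) (s : seq T).
Hypothesis sM : sortable M s.
Let N := size s.
Let n := #|mbases M|.
Implicit Types (A B : {set T}) (m : 'X_{1..n}) (j k : 'I_n).

Let us : uniq s. Proof. by case: sM. Qed.
Let gs : s =i mground M. Proof. by case: sM. Qed.

Definition basis j : {set T} := enum_val j.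

Lemma basisP j : basis j \in mbases M. Proof. exact: enum_valP. Qed.

Definition cover m x := \sum_j m j * (x \in basis j).

Definition interlacedb A B :=
  [forall i : 'I_N.+1, cnt s B i <= cnt s A i <= (cnt s B i).+1].

Lemma interlacedP A B : reflect (interlaced s A B) (interlacedb A B).
Proof.
apply: (iffP forallP) => [h i|h i]; last exact: h.
have [hi|hi] := leqP i N; first exact: (h (Ordinal (hi : i < N.+1))).
by rewrite !(@cnt_oversize _ s _ i) ?(ltnW hi) //; apply: (h ord_max).
Qed.

Definition sorted_pair A B := interlacedb A B || interlacedb B A.

Definition sorted_mon m := [forall j, forall k,
  (0 < m j) && (0 < m k) ==> sorted_pair (basis j) (basis k)].

Lemma sorted_monP m : reflect (forall j k, 0 < m j -> 0 < m k ->
  sorted_pair (basis j) (basis k)) (sorted_mon m).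
Proof.
apply: (iffP forallP) => [h j k mj mk|h j].
  by have /forallP/(_ k) := h j; rewrite mj mk.
by apply/forallP => k; apply/implyP => /andP[]; apply: h.
Qed.

Lemma cnt_mono A a b : a <= b -> cnt s A a <= cnt s A b.
Proof.
by move=> /subnKC <-; rewrite /cnt takeD count_cat leq_addr.
Qed.

Definition icnt A a b := cnt s A b - cnt s A a.

Lemma sorted_pair_icnt A B a b : sorted_pair A B -> a <= b ->
  icnt A a b <= (icnt B a b).+1.
Proof.
rewrite /icnt => h ab; have := cnt_mono A ab; have := cnt_mono B ab.
by case/orP: h => /interlacedP h; have := h a; have := h b; clear; lia.
Qed.

Lemma icnt_sorted_pair A B :
  (forall a b, a <= b -> b <= N -> icnt A a b <= (icnt B a b).+1 /\
     icnt B a b <= (icnt A a b).+1) -> sorted_pair A B.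
Proof.
move=> h.
have h0 b : b <= N -> cnt s A b <= (cnt s B b).+1 /\ cnt s B b <= (cnt s A b).+1.
  by move=> bN; have := h 0 b (leq0n _) bN; rewrite /icnt !cnt0 !subn0.
rewrite /sorted_pair; case e: (interlacedb A B) => //=.
move/negbT/forallPn: e => [a na].
apply/forallP => b; have [aN bN] : a <= N /\ b <= N by split; rewrite -ltnS ltn_ord.
have := h0 a aN; have := h0 b bN; case: (leqP a b) => ab.
  have := h a b ab bN; have := cnt_mono A ab; have := cnt_mono B ab.
  by move: na; rewrite /icnt; clear; lia.
have := h b a (ltnW ab) aN; have := cnt_mono A (ltnW ab); have := cnt_mono B (ltnW ab).
by move: na; rewrite /icnt; clear; lia.
Qed.

Definition weight m := \sum_j m j *
  \sum_(p : 'I_N.+1 * 'I_N.+1) (icnt (basis j) p.1 p.2) ^ 2.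

Lemma weightE m : weight m =
  \sum_(p : 'I_N.+1 * 'I_N.+1) \sum_j m j * (icnt (basis j) p.1 p.2) ^ 2.
Proof. by rewrite exchange_big; apply: eq_bigr => j _; rewrite big_distrr. Qed.

Lemma weightD m1 m2 : weight (m1 + m2)%MM = weight m1 + weight m2.
Proof. by rewrite -big_split /=; apply: eq_bigr => j _; rewrite mnmDE mulnDl. Qed.

Lemma weight0 : weight 0%MM = 0.
Proof. by apply: big1 => j _; rewrite mnm0E. Qed.

Lemma coverD m1 m2 x : cover (m1 + m2)%MM x = cover m1 x + cover m2 x.
Proof. by rewrite -big_split /=; apply: eq_bigr => j _; rewrite mnmDE mulnDl. Qed.

Lemma coverU j x : cover U_(j)%MM x = (x \in basis j).
Proof.
rewrite /cover (bigD1 j) //= mnm1E eqxx mul1n big1 ?addn0 // => k kj.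
by rewrite mnm1E eq_sym (negPf kj).
Qed.

Lemma sum_cnt m a : \sum_j m j * cnt s (basis j) a = \sum_(x <- take a s) cover m x.
Proof.
rewrite exchange_big /=; apply: eq_bigr => j _; rewrite -big_distrr /=; congr (_ * _).
by rewrite /cnt; elim: (take a s) => [|x l IH]; rewrite ?big_nil // big_cons /= IH.
Qed.

Section Fiber.
Variables m m' : 'X_{1..n}.
Hypothesis fib : {in mground M, cover m =1 cover m'}.

Lemma fiber_cnt a :
  \sum_j m j * cnt s (basis j) a = \sum_j m' j * cnt s (basis j) a.
Proof.
rewrite !sum_cnt big_seq [RHS]big_seq; apply: eq_bigr => x /mem_take.
by rewrite gs; apply: fib.
Qed.

Lemma fiber_icnt a b : a <= b ->
  \sum_j m j * icnt (basis j) a b = \sum_j m' j * icnt (basis j) a b.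
Proof.
move=> ab; have e (mm : 'X_{1..n}) : \sum_j mm j * icnt (basis j) a b + \sum_j mm j *
  cnt s (basis j) a =
    \sum_j mm j * cnt s (basis j) b.
  by rewrite -big_split /=; apply: eq_bigr => j _; rewrite -mulnDr subnK ?cnt_mono.
by apply/eqP; rewrite -(eqn_add2r (\sum_j m j * cnt s (basis j) a)) {2}fiber_cnt !e
  fiber_cnt.
Qed.

Lemma fiber_mdeg : 0 < mrank M -> mdeg m = mdeg m'.
Proof.
move=> r0; have e (mm : 'X_{1..n}) : \sum_j mm j * cnt s (basis j) N = mdeg mm * rk M
  (mground M).
  rewrite mdegE big_distrl; apply: eq_bigr => j _; congr (_ * _).
  rewrite /N cnt_size ?(rk_ground_basis (basisP j)) // => x.
  by rewrite gs; apply/subsetP/mbases_sub/basisP.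
have := fiber_cnt N; rewrite !e => /eqP; rewrite eqn_pmul2r => [/eqP //|].
move: r0; rewrite /mrank /rk => /leq_trans; apply.
by apply/eq_leq/eq_bigr => B /mbases_sub/setIidPr ->.
Qed.

End Fiber.

(* This is (c - q)(c - q - 1) >= 0, with both sides moved to avoid subtraction. *)
Lemma two_values_min c q :
  (q.*2).+1 * c <= c ^ 2 + q * q.+1 ?= iff ((c == q) || (c == q.+1)).
Proof.
apply/leqifP; case: ifP => [/orP[]/eqP -> |/negbT]; [nia | nia |].
rewrite negb_or => /andP[/eqP h1 /eqP h2]; case: (ltngtP c q) => // h.
  have -> : q = c + (q - c) by lia.
  have : 0 < q - c by lia.
  move: (q - c) => d; nia.
have -> : c = q.+2 + (c - q.+2) by lia.
move: (c - _) => d; nia.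
Qed.

Lemma two_values_sum_min (c : 'I_n -> nat) q m m' : mdeg m = mdeg m' ->
  \sum_j m j * c j = \sum_j m' j * c j ->
  (forall j, 0 < m j -> (c j == q) || (c j == q.+1)) ->
  \sum_j m j * c j ^ 2 <= \sum_j m' j * c j ^ 2 ?= iff
    [forall j, (0 < m' j) ==> (c j == q) || (c j == q.+1)].
Proof.
move=> ed el hm.
have e (mm : 'X_{1..n}) : \sum_j mm j * (c j ^ 2 + q * q.+1) =
    \sum_j mm j * c j ^ 2 + mdeg mm * (q * q.+1).
  by rewrite mdegE big_distrl -big_split /=; apply: eq_bigr => j _; rewrite mulnDr.
have f (mm : 'X_{1..n}) : \sum_j mm j * ((q.*2).+1 * c j) = (q.*2).+1 * \sum_j mm j *
  c j.
  by rewrite big_distrr; apply: eq_bigr => j _; rewrite mulnCA.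
have e1 : \sum_j m j * (c j ^ 2 + q * q.+1) = (q.*2).+1 * \sum_j m j * c j.
  rewrite -f; apply: eq_bigr => j _; case: (posnP (m j)) => [-> //|/hm h].
  by congr (_ * _); apply/esym/eqP; rewrite (two_values_min (c j) q).2.
have t j : true -> m' j * ((q.*2).+1 * c j) <= m' j * (c j ^ 2 + q * q.+1)
    ?= iff ((0 < m' j) ==> (c j == q) || (c j == q.+1)).
  move=> _; have [h1 h2] := two_values_min (c j) q.
  case: posnP => [->|m0] /=; first by rewrite !mul0n.
  by split; [rewrite leq_pmul2l | rewrite eqn_pmul2l].
have [] := leqif_sum t; rewrite f -el e -e1 e ed leq_add2r eqn_add2r => h1 h2.
by split.
Qed.

Lemma sorted_two_values m a b : sorted_mon m -> a <= b ->
  exists q, forall j, 0 < m j -> (icnt (basis j) a b == q) || (icnt (basis j) a b ==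
    q.+1).
Proof.
move=> /sorted_monP sm ab.
have [/existsP[j0 mj0]|/existsPn h] := boolP [exists j, 0 < m j]; last first.
  by exists 0 => j /(negP (h j)).
have [j mj minj] := @arg_minnP _ j0 (fun j => 0 < m j) (fun j => icnt (basis j) a b)
  mj0.
exists (icnt (basis j) a b) => k mk.
have := minj k mk; have := sorted_pair_icnt (sm k j mk mj) ab; clear; lia.
Qed.

Lemma sorted_weight_min m m' : 0 < mrank M -> sorted_mon m ->
  {in mground M, cover m =1 cover m'} ->
  weight m <= weight m' /\ (weight m = weight m' -> sorted_mon m').
Proof.
move=> r0 sm fib; have ed := fiber_mdeg fib r0.
pose S (mm : 'X_{1..n}) (p : 'I_N.+1 * 'I_N.+1) := \sum_j mm j * (icnt (basis j) p.1
  p.2) ^ 2.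
have key p : S m p <= S m' p /\ (S m p = S m' p -> p.1 <= p.2 ->
    forall j k, 0 < m' j -> 0 < m' k ->
      icnt (basis j) p.1 p.2 <= (icnt (basis k) p.1 p.2).+1).
  have [ab|ba] := leqP p.1 p.2; last first.
    suff z (mm : 'X_{1..n}) : S mm p = 0 by rewrite !z.
    apply: big1 => j _; rewrite /icnt (_ : _ - _ = 0) ?muln0 //.
    by apply/eqP; rewrite subn_eq0 cnt_mono // ltnW.
  have [q hq] := sorted_two_values sm ab.
  have [h1 h2] := two_values_sum_min ed (fiber_icnt fib ab) hq.
  split=> // /eqP; rewrite h2 => /forallP h _ j k mj mk.
  by have := h j; have := h k; rewrite mj mk /=; clear; lia.
have k' p : true -> S m p <= S m' p ?= iff (S m p == S m' p).
  by move=> _; split=> //; case: (key p).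
have [] := leqif_sum k'; rewrite -!weightE => h1 h2; split=> // /eqP.
rewrite h2 => /forallP h; apply/sorted_monP => j k mj mk.
apply: icnt_sorted_pair => a b ab bN.
have [_] := key (inord a, inord b).
rewrite /= !inordK ?ltnS ?(leq_trans ab bN) // => hh.
by have {}hh := hh (eqP (h (inord a, inord b))) ab; split; apply: hh.
Qed.

Lemma sorted_mon_top m : sorted_mon m -> 0 < mdeg m -> exists2 j, 0 < m j &
  forall k, 0 < m k -> forall i, cnt s (basis k) i <= cnt s (basis j) i <= (cnt s
    (basis k) i).+1.
Proof.
move=> /sorted_monP sm m0.
have cmp j k : 0 < m j -> 0 < m k ->
    interlaced s (basis j) (basis k) \/ interlaced s (basis k) (basis j).
  by move=> mj mk; case/orP: (sm j k mj mk) => /interlacedP; [left | right].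
have ex (l : seq 'I_n) : all (fun j => 0 < m j) l -> l != [::] -> exists2 j, 0 < m j &
    forall k, k \in l -> forall i, cnt s (basis k) i <= cnt s (basis j) i.
  elim: l => // x l IH /= /andP[mx ml] _.
  have [->|l0] := eqVneq l [::].
    by exists x => // k; rewrite inE => /eqP ->.
  have [j mj jt] := IH ml l0; have [h|h] := cmp x j mx mj.
    exists x => // k; rewrite inE => /predU1P[-> //|/jt kj i].
    by apply: leq_trans (kj i) _; case/andP: (h i).
  exists j => // k; rewrite inE => /predU1P[-> i|/jt //].
  by case/andP: (h i).
have [||j mj jt] := ex (filter (fun j => 0 < m j) (enum 'I_n)).
- exact: filter_all.
- rewrite -size_eq0 size_filter -lt0n -has_count; apply/hasP.
  have /existsP[j mj] : [exists j, 0 < m j].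
    apply: contraTT m0 => /existsPn h; rewrite -leqNgt mdegE big1 // => j _.
    by apply/eqP; rewrite eqn0Ngt h.
  by exists j; rewrite ?mem_enum.
exists j => // k mk i; have jk : cnt s (basis k) i <= cnt s (basis j) i.
  by apply: jt; rewrite mem_filter mk mem_enum.
rewrite jk /=; have [h|h] := cmp j k mj mk; case/andP: (h i) => // h1 h2.
by apply: leq_trans h1 _.
Qed.

Lemma cnt_inj A B : A \subset mground M -> B \subset mground M ->
  cnt s A =1 cnt s B -> A = B.
Proof.
move=> sA sB h; apply/setP => x.
have [xE|xE] := boolP (x \in mground M); last first.
  by rewrite (contraNF (subsetP sA x) xE) (contraNF (subsetP sB x) xE).
have step C : cnt s C (index x s).+1 = cnt s C (index x s) + (x \in C).
  rewrite /cnt (take_nth x) ?index_mem ?gs // nth_index ?gs //.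
  by rewrite -cats1 count_cat /= addn0.
have := h (index x s).+1; rewrite !step h => /addnI.
by case: (x \in A); case: (x \in B).
Qed.

Lemma sorted_mon_inj m m' : 0 < mrank M -> sorted_mon m -> sorted_mon m' ->
  {in mground M, cover m =1 cover m'} -> m = m'.
Proof.
move=> r0; move: {2}(mdeg m) (erefl (mdeg m)) => d.
elim: d m m' => [|d IH] m m' dm sm sm' fib; have dm' := fiber_mdeg fib r0.
  have -> : m = 0%MM by apply/eqP; rewrite -mdeg_eq0 dm.
  by apply/esym/eqP; rewrite -mdeg_eq0 -dm' dm.
have [|j mj jt] := sorted_mon_top sm; first by rewrite dm.
have [|k mk kt] := sorted_mon_top sm'; first by rewrite -dm' dm.
(* The heights of the top basis are determined by the fiber: they are the means
   of the heights of the bases of m, rounded up. *)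
have le (m1 m2 : 'X_{1..n}) j1 j2 : mdeg m1 = mdeg m2 -> {in mground M, cover m1 =1
  cover m2} ->
    0 < m1 j1 -> (forall l, 0 < m1 l -> forall i,
      cnt s (basis l) i <= cnt s (basis j1) i <= (cnt s (basis l) i).+1) ->
    (forall l, 0 < m2 l -> forall i,
      cnt s (basis l) i <= cnt s (basis j2) i <= (cnt s (basis l) i).+1) ->
    forall i, cnt s (basis j1) i <= cnt s (basis j2) i.
  move=> e12 f12 m1j t1 t2 i.
  have u2 : \sum_l m2 l * cnt s (basis l) i <= mdeg m2 * cnt s (basis j2) i.
    rewrite mdegE big_distrl; apply: leq_sum => l _.
    by case: (posnP (m2 l)) => [-> //|/t2/(_ i)/andP[h _]]; rewrite leq_mul2l h orbT.
  have u1 : mdeg m1 * cnt s (basis j1) i < \sum_l m1 l * cnt s (basis l) i + mdeg m1.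
    rewrite mdegE big_distrl -big_split /= (bigD1 j1) //= [ltnRHS](bigD1 j1) //=.
    rewrite -addSn leq_add //; first by move: m1j; clear; lia.
    apply: leq_sum => l _; rewrite -mulnSr.
    by case: (posnP (m1 l)) => [-> //|/t1/(_ i)/andP[_ h]]; rewrite leq_mul2l h orbT.
  have m20 : 0 < mdeg m2 by rewrite -e12 mdegE (bigD1 j1) //= ltn_addr.
  move: u1; rewrite (fiber_cnt f12) e12 => h.
  rewrite -ltnS -(ltn_pmul2l m20); apply: leq_trans h _.
  by rewrite mulnSr leq_add2r.
have fib' : {in mground M, cover m' =1 cover m} by move=> x xM; rewrite fib.
have jk : basis j = basis k.
  apply: cnt_inj => [||i]; try exact: mbases_sub (basisP _).
  apply/eqP; rewrite eqn_leq; apply/andP; split.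
    exact: (le m m' j k dm' fib mj jt kt).
  exact: (le m' m k j (esym dm') fib' mk kt jt).
move/enum_val_inj: jk => jk; subst k.
have leU (m1 : 'X_{1..n}) : 0 < m1 j -> (U_(j) <= m1)%MM.
  move=> h; apply/mnm_lepP => l; rewrite mnm1E.
  by case: eqP => [<-|_].
have sub (m1 : 'X_{1..n}) : sorted_mon m1 -> sorted_mon (m1 - U_(j))%MM.
  move=> /sorted_monP h; apply/sorted_monP => a b; rewrite !mnmBE => ha hb.
  by apply: h; [apply: leq_trans ha (leq_subr _ _) | apply: leq_trans hb (leq_subr _
    _)].
rewrite -(submK (leU _ mj)) -(submK (leU _ mk)); congr (_ + _)%MM.
apply: IH; [|exact: sub|exact: sub|].
  have : mdeg (m - U_(j) + U_(j))%MM = d.+1 by rewrite submK ?leU.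
  by rewrite mdegD mdeg1 addn1 => -[].
move=> x xM; have := fib x xM.
by rewrite -{1}(submK (leU _ mj)) -{1}(submK (leU _ mk)) !coverD => /addIn.
Qed.

Lemma sort_mon j k : exists j' k',
  sorted_mon (U_(j') + U_(k'))%MM /\
  forall x, cover (U_(j') + U_(k'))%MM x = cover (U_(j) + U_(k))%MM x.
Proof.
have [_ _ h] := sM.
have [A [B [AM BM eAB il]]] := h _ _ (basisP j) (basisP k).
exists (enum_rank_in AM A), (enum_rank_in BM B).
have bA : basis (enum_rank_in AM A) = A by rewrite /basis enum_rankK_in.
have bB : basis (enum_rank_in BM B) = B by rewrite /basis enum_rankK_in.
have refl C : sorted_pair C C.
  by apply/orP; left; apply/interlacedP => i; rewrite leqnn leqnSn.
split; last by move=> x; rewrite !coverD !coverU bA bB eAB.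
have ab : sorted_pair A B by apply/orP; left; apply/interlacedP.
have ba : sorted_pair B A by rewrite /sorted_pair orbC.
apply/sorted_monP => a b; rewrite !mnmDE !mnm1E.
have two (x y c : 'I_n) : 0 < (x == c) + (y == c) -> c = x \/ c = y.
  by case: eqP => [->|_]; [left | case: eqP => [->|_]; [right |]].
by move=> /two[] -> /two[] ->; rewrite ?bA ?bB.
Qed.

Definition sort_order : rel 'X_{1..n} := fun m1 m2 =>
  (weight m1 < weight m2) || (weight m1 == weight m2) && (m1 <= m2)%O.

Lemma sort_order_monomial : monomial_order sort_order.
Proof.
rewrite /sort_order; split.
- by move=> m; rewrite ltnn eqxx /=; apply: Order.POrderTheory.lexx.
- move=> m1 m2 /andP[/orP[h1|/andP[/eqP e h1]] /orP[h2|/andP[/eqP e' h2]]].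
  + by have := ltn_trans h1 h2; rewrite ltnn.
  + by rewrite e' ltnn in h1.
  + by rewrite e ltnn in h2.
  + by apply: Order.POrderTheory.le_anti; rewrite h1.
- move=> m2 m1 m3 /orP[h1|/andP[/eqP -> h1]] /orP[h2|/andP[/eqP e h2]].
  + by rewrite (ltn_trans h1 h2).
  + by rewrite -e h1.
  + by rewrite h2.
  + by rewrite e eqxx (Order.POrderTheory.le_trans h1 h2) orbT.
- move=> m1 m2; case: ltngtP => //= _; exact: Order.TotalTheory.le_total.
- split=> [m|m1 m2 m].
    by rewrite weight0; case: posnP => //= ->; rewrite le0m.
  by rewrite !weightD ltn_add2r eqn_add2r lemc_add2l.
Qed.

End Weights.

(** * The toric ideal *)

Section IdealSpan.
Variables (K : fieldType) (n : nat).
Implicit Types (S : {mpoly K[n]} -> Prop) (p q : {mpoly K[n]}).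
Local Open Scope ring_scope.

Lemma ideal_span_gen S p q : S q -> ideal_span S (p * q).
Proof.
move=> Sq; exists [:: (p, q)]; last by rewrite big_seq1.
by move=> c; rewrite inE => /eqP ->.
Qed.

Lemma ideal_spanD S p q : ideal_span S p -> ideal_span S q -> ideal_span S (p + q).
Proof.
move=> [s hs ->] [t ht ->]; exists (s ++ t); last by rewrite big_cat.
by move=> c; rewrite mem_cat => /orP[/hs|/ht].
Qed.

Lemma ideal_span0 S : ideal_span S 0.
Proof. by exists [::]; rewrite ?big_nil. Qed.

Lemma ideal_spanM S p q : ideal_span S q -> ideal_span S (p * q).
Proof.
move=> [s hs ->]; exists [seq (p * c.1, c.2) | c <- s].
  by move=> _ /mapP[c /hs h ->].
rewrite big_map big_distrr; apply: eq_bigr => c _ /=; exact: mulrA.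
Qed.

Lemma ideal_span_sub S S' p : (forall q, S q -> ideal_span S' q) ->
  ideal_span S p -> ideal_span S' p.
Proof.
move=> h [s hs ->]; elim: s hs => [|c s IH] hs.
  by rewrite big_nil; apply: ideal_span0.
rewrite big_cons; apply: ideal_spanD.
  by apply/ideal_spanM/h/hs; rewrite mem_head.
by apply: IH => d ds; apply: hs; rewrite in_cons ds orbT.
Qed.

End IdealSpan.

Section Toric.
Variables (K : fieldType) (T : finType) (M : matroid T).
Let n := #|mbases M|.
Local Open Scope ring_scope.

Definition toric_exponent (m : 'X_{1..n}) : 'X_{1..#|mground M|} :=
  [multinom cover m (enum_val i) | i < #|mground M|].

Lemma toric_exponent_eq m m' : toric_exponent m = toric_exponent m' <->
  {in mground M, cover m =1 cover m'}.
Proof.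
split=> [/mnmP h x xM|h]; last first.
  by apply/mnmP => i; rewrite !mnmE h // enum_valP.
by have := h (enum_rank_in xM x); rewrite !mnmE enum_rankK_in.
Qed.

Lemma toric_mapX m : toric_map (M := M) ('X_[m] : {mpoly K[n]}) = 'X_[toric_exponent m].
Proof.
rewrite /toric_map comp_mpolyX [RHS]mpolyXE_id.
transitivity (\prod_(j < n) \prod_(i < #|mground M|)
    'X_i ^+ (m j * (enum_val i \in basis j))%N : {mpoly K[#|mground M|]}).
  apply: eq_bigr => j _; rewrite tnth_mktuple /toric_monomial big_mkcond -prodrXl.
  apply: eq_bigr => i _; rewrite mulnC exprM.
  by rewrite /basis; case: (_ \in _); rewrite ?expr1 ?expr0.
rewrite exchange_big; apply: eq_bigr => i _.
by rewrite mnmE prodrXr.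
Qed.

Lemma toric_mapE (p : {mpoly K[n]}) : toric_map (M := M) p =
  \sum_(m <- msupp p) p@_m *: ('X_[toric_exponent m] : {mpoly K[_]}).
Proof.
rewrite {1}(mpolyE p) /toric_map raddf_sum; apply: eq_bigr => m _ /=.
by rewrite comp_mpolyZ; congr (_ *: _); apply: toric_mapX.
Qed.

Lemma toric_ideal_partner p m : toric_ideal K M p -> m \in msupp p ->
  exists m', [/\ m' \in msupp p, m' != m & toric_exponent m' = toric_exponent m].
Proof.
move=> Jp mp.
have [/hasP[m' m'p /andP[ne /eqP e]]|/hasPn no] := boolP (has (fun m' =>
    (m' != m) && (toric_exponent m' == toric_exponent m)) (msupp p)).
  by exists m'.
have := congr1 (mcoeff (toric_exponent m)) Jp.
rewrite toric_mapE mcoeff0 raddf_sum /= (bigD1_seq m) ?msupp_uniq //=.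
rewrite mcoeffZ mcoeffX eqxx mulr1 big1_seq ?addr0.
  by move/eqP; rewrite mcoeff_eq0 mp.
move=> m' /andP[ne m'p]; rewrite mcoeffZ mcoeffX.
by have := no m' m'p; rewrite ne /= => /negPf ->; rewrite mulr0.
Qed.

Definition fiber_quadrics : seq {mpoly K[n]} :=
  [seq 'X_[U_(q.1.1) + U_(q.1.2)] - 'X_[U_(q.2.1) + U_(q.2.2)]
  | q <- enum {: ('I_n * 'I_n) * ('I_n * 'I_n)}
  & let u := (U_(q.1.1) + U_(q.1.2))%MM in let v := (U_(q.2.1) + U_(q.2.2))%MM in
    (u != v) && (toric_exponent u == toric_exponent v)].

Lemma fiber_quadricsP g : reflect (exists j k j' k',
    let u := (U_(j) + U_(k))%MM in let v := (U_(j') + U_(k'))%MM in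
    [/\ u != v, toric_exponent u = toric_exponent v & g = 'X_[u] - 'X_[v]])
  (g \in fiber_quadrics).
Proof.
apply: (iffP mapP) => [[q]|[j [k [j' [k' /= [h1 h2 ->]]]]]].
  rewrite mem_filter => /andP[/andP[h1 /eqP h2] _] ->.
  by exists q.1.1, q.1.2, q.2.1, q.2.2.
by exists ((j, k), (j', k')); rewrite // mem_filter mem_enum /= h1 h2 eqxx.
Qed.

Lemma fiber_quadric_toric g : g \in fiber_quadrics -> toric_ideal K M g.
Proof.
case/fiber_quadricsP => j [k [j' [k' /= [_ e ->]]]].
have X m := toric_mapX m; rewrite /toric_map in X.
by rewrite /toric_ideal /toric_map raddfB /= !X e subrr.
Qed.

Lemma fiber_quadric_quadratic g : g \in fiber_quadrics -> quadratic_binomial g.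
Proof.
case/fiber_quadricsP => j [k [j' [k' /= [ne e ->]]]].
by exists (U_(j) + U_(k))%MM, (U_(j') + U_(k'))%MM; split=> //; rewrite mdegD !mdeg1.
Qed.

Lemma fiber_quadrics_groebner s : sortable M s -> (0 < mrank M)%N ->
  groebner_basis (@sort_order _ M s) (toric_ideal K M) fiber_quadrics.
Proof.
move=> sM r0; split=> [g|p]; first exact: fiber_quadric_toric.
split; apply: ideal_span_sub => q [g [m [Jg lm ->]]]; last first.
  rewrite -[X in ideal_span _ X]mul1r; apply: ideal_span_gen.
  by exists g, m; split=> //; apply: fiber_quadric_toric.
have [mg ml] := lm.
have [m' [m'g ne /toric_exponent_eq fib]] := toric_ideal_partner Jg mg.
have fib' : {in mground M, cover m =1 cover m'} by move=> x xM; rewrite fib.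
have nsm : ~~ sorted_mon s m.
  apply/negP => sm; have [le eqw] := sorted_weight_min sM r0 sm fib'.
  have := ml _ m'g; rewrite /sort_order ltnNge le /= => /andP[/eqP e _].
  by move/eqP: ne; apply; apply: (sorted_mon_inj sM r0 (eqw (esym e)) sm).
move: nsm => /forallPn[j /forallPn[k]]; rewrite negb_imply => /andP[/andP[mj mk] nsp].
have [j' [k' [sv cv]]] := sort_mon sM j k.
set u := (U_(j) + U_(k))%MM; set v := (U_(j') + U_(k'))%MM in sv cv.
have jk : j != k.
  apply: contra nsp => /eqP ->; apply/orP; left; apply/interlacedP => i.
  by rewrite leqnn leqnSn.
have um : (u <= m)%MM.
  apply/mnm_lepP => l; rewrite mnmDE !mnm1E.
  case: eqP => [<-|_]; last by case: eqP => [<-|_].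
  by rewrite eq_sym (negPf jk).
have nsu : ~~ sorted_mon s u.
  apply: contra nsp => /sorted_monP; apply; rewrite mnmDE !mnm1E eqxx //.
  by rewrite addn1.
have [le eqw] := sorted_weight_min sM r0 sv (m' := u) (fun x _ => cv x).
have lt : (weight s v < weight s u)%N.
  by rewrite ltn_neqAle le andbT; apply: contra nsu => /eqP.
have uv : u != v by apply: contraTneq lt => ->; rewrite ltnn.
rewrite -(submK um) mpolyXD; apply: ideal_span_gen.
exists ('X_[u] - 'X_[v]), u; split=> //.
  apply/fiber_quadricsP; exists j, k, j', k'; split=> //.
  by apply/toric_exponent_eq => x _; rewrite cv.
split; first by rewrite mcoeff_msupp mcoeffB !mcoeffX eqxx (eq_sym v) (negPf uv) subr0
  oner_eq0.
move=> w /msuppB_le; rewrite mem_cat !msuppX !inE /sort_order => /orP[] /eqP ->.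
  by rewrite eqxx Order.POrderTheory.lexx orbT.
by rewrite lt.
Qed.

End Toric.

Theorem theorem3p4 (K : fieldType) (T : finType) (M : matroid T)
    (rankM : (0 < mrank M)%N)
    (noMK4 : ~ has_minor M MK4) (noW3 : ~ has_minor M W3)
    (noP6 : ~ has_minor M P6) (noQ6 : ~ has_minor M Q6) :
  exists ord : rel 'X_{1..#|mbases M|}, monomial_order ord /\
    exists2 G : seq {mpoly K[#|mbases M|]},
      groebner_basis ord (toric_ideal K M) G &
      forall g, g \in G -> quadratic_binomial g.
Proof.
have [|s sM] := @sortable_of_no_forbidden_minor T M; first by case.
exists (@sort_order _ M s); split; first exact: sort_order_monomial.
exists (fiber_quadrics K M); first exact: fiber_quadrics_groebner.
exact: fiber_quadric_quadratic.
Qed.
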